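(* Let $a,b\in\mathbb{C}$, $r\in\mathbb{N}$, $\mathbf{m}=(m_1,\dots,m_r)\in\mathbb{N}^r$, $m=m_1+\cdots+m_r$, $\mathbf{f}=(f_1,\dots,f_r)\in\mathbb{C}^r$. Suppose $a+1\notin-\mathbb{N}_0$, $a-b\notin\{0,\ldots,m-1\}$ and $f_j-a\notin\{1-m_j,2-m_j,\ldots,0\}$ for $1\le j\le r$. Then for $x\in\mathbb{C}\setminus[1,\infty)$ $$(1-x)^{b+m-1}\,{}_{r+2}F_{r+1}\left(\begin{matrix}a,b,\mathbf{f}+\mathbf{m}\\ a+1,\mathbf{f}\end{matrix}\,\middle|\,x\right)=\sum_{j=0}^{m-1}\frac{(1-m)_j(a-b-m+1)_{j}}{(a+1)_{j}\,j!}\hat{Q}^0_m(-j)x^j$$ $$+\frac{x^{m}(-1)^m(b)_m(\mathbf{f}-a)_{\mathbf{m}}}{(a+1)_{m}(\mathbf{f})_{\mathbf{m}}}\,{}_{2}F_{1}\left(\begin{matrix}1,1-b+a\\ a+m+1\end{matrix}\,\middle|\,x\right),$$ where $$\hat{Q}^0_m(-j)=\sum_{k=0}^{j}\frac{(-1)^k(-j)_{k}(a)_k(b)_kC_{k,r}}{(1-m)_k(a-b-m+1)_k}\,{}_{3}F_{2}\left(\begin{matrix}k-m,\,k-j,\,1-b-m\\ k-m+1,\,a-b-m+k+1\end{matrix}\right).$$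
   Context: $\mathbb{N}=\{1,2,\dots\}$, $\mathbb{N}_0=\mathbb{N}\cup\{0\}$; $(z)_k=z(z+1)\cdots(z+k-1)$, $(z)_0=1$; $(\mathbf{f}+s)_{\mathbf{m}}=\prod_{j=1}^r(f_j+s)_{m_j}$. ${}_pF_q$ is the generalized hypergeometric function $\sum_{n\ge0}\frac{(a_1)_n\cdots(a_p)_n}{(b_1)_n\cdots(b_q)_n}\frac{z^n}{n!}$, and for $p=q+1$ it is understood as its analytic continuation to $z\in\mathbb{C}\setminus[1,\infty)$; when $z$ is omitted, $z=1$. As usual, no bottom parameter is a nonpositive integer (in particular no $f_j$ is), except that the ${}_3F_2$ in $\hat Q^0_m(-j)$ is the finite sum $\sum_{i=0}^{j-k}\frac{(k-m)_i(k-j)_i(1-b-m)_i}{(k-m+1)_i(a-b-m+k+1)_i\,i!}$. In parameter lists $\mathbf{f}$ means $f_1,\dots,f_r$ and $\mathbf{f}+\mathbf{m}$ means $f_1+m_1,\dots,f_r+m_r$. Powers of $1-x$ are principal branches. The coefficients are $C_{k,r}=\frac{(-1)^k}{k!}\,{}_{r+1}F_r\left(\begin{matrix}-k,\mathbf{f}+\mathbf{m}\\ \mathbf{f}\end{matrix}\right)=\frac{(-1)^k}{k!}\sum_{i=0}^k\frac{(-k)_i}{i!}\prod_{j=1}^r\frac{(f_j+m_j)_i}{(f_j)_i}$ for $0\le k\le m$. *)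

(* Defs.v *)
(* Stdlib reals, with Coquelicot's complex numbers, finite sums and power
   series. *)
From Stdlib Require Export Arith Reals ClassicalEpsilon.
From Coquelicot Require Export Coquelicot.
From Stdlib Require Export List.

(* With RtoC this lets naturals be used as complex numbers; a difference of
   naturals written in C_scope is the complex (untruncated) difference. *)
Coercion INR : nat >-> R.

Open Scope C_scope.

Fixpoint poch (z : C) (k : nat) : C :=
  match k with
  | O => 1
  | S k' => poch z k' * (z + k')
  end.

Definition Cprod (l : list C) : C := fold_right Cmult 1 l.

(* (z_1)_{m_1} ... (z_r)_{m_r} *)
Definition vpoch (z : list C) (mv : list nat) : C :=
  Cprod (map (fun p => poch (fst p) (snd p)) (combine z mv)).

(* f_1 + s, ..., f_r + s *)
Definition shift (f : list C) (s : C) : list C := map (fun z => z + s) f.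

(* f_1 + m_1, ..., f_r + m_r *)
Definition vshift (f : list C) (mv : list nat) : list C :=
  map (fun p : C * nat => fst p + snd p) (combine f mv).

Definition nonpos_int (z : C) : Prop := exists n : nat, z = - n.

Definition hyp_coef (top bot : list C) (n : nat) : C :=
  Cprod (map (fun z => poch z n) top) /
  (Cprod (map (fun z => poch z n) bot) * fact n).

(* The sum of the terms of index 0, ..., N of the hypergeometric series; this
   is the value of a series that terminates at N because of a top parameter
   -N. *)
Definition hyp_sum (N : nat) (top bot : list C) (z : C) : C :=
  sum_n (fun n => hyp_coef top bot n * z ^ n) N.

Definition slit_plane (z : C) : Prop := ~ (Im z = 0%R /\ (1 <= Re z)%R).

Definition C_pseries (c : nat -> C) (z l : C) : Prop :=
  @is_pseries C_AbsRing C_NormedModule c z l.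

Definition analytic_at (F : C -> C) (z0 : C) : Prop :=
  exists (c : nat -> C) (d : R), (0 < d)%R /\
    forall z : C, (Cmod (z - z0) < d)%R -> C_pseries c (z - z0) (F z).

Definition is_hyp_continuation (top bot : list C) (F : C -> C) : Prop :=
  (forall z : C, (Cmod z < 1)%R -> C_pseries (hyp_coef top bot) z (F z)) /\
  (forall z : C, slit_plane z -> analytic_at F z).

(* The function _{q+1}F_q on C \ [1, +oo): on the slit plane, which is
   connected, its values do not depend on the continuation that is chosen.
   The values on the cut [1, +oo) are meaningless. *)
Definition hyp (top bot : list C) : C -> C :=
  epsilon (inhabits (fun _ : C => RtoC 0)) (is_hyp_continuation top bot).

Definition Cexp (z : C) : C :=
  ((exp (Re z) * cos (Im z))%R, (exp (Re z) * sin (Im z))%R).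

(* Principal argument, by the half-angle formula; it is the right value, in
   (-PI, PI), for every z outside the cut (-oo, 0], and is only used there. *)
Definition Carg (z : C) : R := (2 * atan (Im z / (Cmod z + Re z)))%R.

Definition Clog (z : C) : C := (ln (Cmod z), Carg z).

Definition Cpower (z s : C) : C := Cexp (s * Clog z).

(* C_{k,r} *)
Definition Ccoef (f : list C) (mv : list nat) (k : nat) : C :=
  (-1) ^ k / fact k * hyp_sum k (- k :: vshift f mv) f 1.

(* \hat Q^0_m(-j). The 3F2 is the sum stopped at the index j - k, although
   its bottom parameter k - m + 1 is a nonpositive integer (k <= j < m). *)
Definition Qhat0 (a b : C) (f : list C) (mv : list nat) (m j : nat) : C :=
  sum_n (fun k : nat =>
    (-1) ^ k * poch (- j) k * poch a k * poch b k * Ccoef f mv k /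
    (poch (1 - m) k * poch (a - b - m + 1) k) *
    hyp_sum (j - k)%nat
      (k - m :: k - j :: 1 - b - m :: nil)
      (k - m + 1 :: a - b - m + k + 1 :: nil) 1) j.

(* Main.v *)
Require Import Defs.
From Stdlib Require Import Lia Lra.

(* Since (a)_n/(a+1)_n = a/(a+n), and since (f+m)_n/(f)_n is a polynomial of
   degree m in n whose Newton coefficients are the C_{k,r}, the left-hand
   function is a combination of the x^k 2F1(a+k, b+k; a+k+1; x), 0 <= k <= m.
   After multiplication by (1-x)^(b+m-1) the coefficients of each summand satisfy
   a two-term recurrence with the inhomogeneity (k-m)_n/n!, which vanishes for
   n > m-k. It is solved by partial sums of a Gauss series at 1; these are the 3F2
   below x^m, and from x^m on a multiple of 2F1(1, a-b+1; a+m+1; x) is left.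

   This proves the identity on the unit disc. For the slit plane it is enough to
   continue 2F1(1, c; d; x): shifting c and d reduces to Re d > 2, where Euler's
   integral is expanded locally by the binomial series. Two continuations agree by
   the isolation of zeros, followed along the segment from 0 to x. *)

(** * Finite sums and Pochhammer symbols *)

(** [hyp] is chosen by [epsilon], so it can be used only where some continuation has been exhibited.
    The function on the left is never continued on its own: the right-hand side times (1-x)^(1-b-m)
    is shown to be a continuation of its series, and uniqueness does the rest. Hence existence is an
    issue for 2F1(1, c; d; x) alone.

    The recurrence yields truncated sums of 2F1(-p, A; D; 1) with p = m-k, whereas [Qhat0] contains
    3F2 sums that also carry 1-b-m; [gauss_sum_3F2] is the bridge. At x^m the truncated sum is
    complete and Chu-Vandermonde evaluates it. Beyond x^m the k-th summand carries (-1)^k (a)_k, the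
    value at -a of the falling factorial of order k, so the sum over k is the Newton expansion of
    the weight polynomial at -a. This is the origin of (f-a)_m/(f)_m.

    The bound Re d > 2 makes the integrand of Euler's integral continuous on [0, 1], so that no
    improper integral occurs. *)

Lemma Cmult_eq_reg_l (c u v : C) : c <> 0 -> c * u = c * v -> u = v.
Proof.
  intros Hc H. transitivity (/ c * (c * u)); [field; exact Hc|].
  rewrite H. field. exact Hc.
Qed.

Lemma Cinv_neq_0 (c : C) : c <> 0 -> / c <> 0.
Proof.
  intros Hc H. apply C1_nz. rewrite <- (Cinv_r c Hc), H. ring.
Qed.

Lemma csum_O (u : nat -> C) : sum_n u 0 = u 0%nat :> C.
Proof. exact (sum_O u). Qed.

Lemma csum_S (u : nat -> C) n : sum_n u (S n) = sum_n u n + u (S n) :> C.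
Proof. exact (sum_Sn u n). Qed.

Lemma csum_ext (u v : nat -> C) n :
  (forall k, (k <= n)%nat -> u k = v k) -> sum_n u n = sum_n v n :> C.
Proof. exact (sum_n_ext_loc u v n). Qed.

Lemma csum_plus (u v : nat -> C) n :
  sum_n (fun k => u k + v k) n = sum_n u n + sum_n v n :> C.
Proof. exact (sum_n_plus u v n). Qed.

Lemma csum_mult_l (c : C) (u : nat -> C) n :
  sum_n (fun k => c * u k) n = c * sum_n u n :> C.
Proof. exact (sum_n_mult_l (K := C_Ring) c u n). Qed.

Lemma csum_shift (u : nat -> C) n :
  sum_n u (S n) = u 0%nat + sum_n (fun k => u (S k)) n :> C.
Proof.
  induction n as [|n IH].
  - now rewrite csum_S, !csum_O.
  - rewrite csum_S, IH, (csum_S (fun k => u (S k))). ring.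
Qed.

Lemma csum_rev (u : nat -> C) n :
  sum_n u n = sum_n (fun k => u (n - k)%nat) n :> C.
Proof.
  induction n as [|n IH]; [now rewrite !csum_O|].
  rewrite csum_S, (csum_shift (fun k => u (S n - k)%nat)), IH.
  simpl. ring.
Qed.

Lemma csum_zero (u : nat -> C) n :
  (forall k, (k <= n)%nat -> u k = 0) -> sum_n u n = 0 :> C.
Proof.
  induction n as [|n IH]; intros H; [rewrite csum_O; apply H; lia|].
  rewrite csum_S, IH by (intros; apply H; lia).
  rewrite H by lia. ring.
Qed.

Lemma csum_extend (u : nat -> C) n N :
  (n <= N)%nat -> (forall k, (n < k <= N)%nat -> u k = 0) ->
  sum_n u N = sum_n u n :> C.
Proof.
  induction N as [|N IH]; intros Hn H.
  - now replace n with 0%nat by lia.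
  - destruct (Nat.eq_dec n (S N)) as [->|Hne]; [reflexivity|].
    rewrite csum_S, IH, H; [ring|lia|lia|intros; apply H; lia].
Qed.

Lemma csum_switch (u : nat -> nat -> C) n p :
  sum_n (fun i => sum_n (fun j => u i j) p) n =
  sum_n (fun j => sum_n (fun i => u i j) n) p :> C.
Proof. exact (sum_n_switch u n p). Qed.

Lemma RtoC_INR_S n : RtoC (INR (S n)) = RtoC (INR n) + 1.
Proof. now rewrite S_INR, RtoC_plus. Qed.

Lemma RtoC_INR_plus n p : RtoC (INR (n + p)) = RtoC (INR n) + RtoC (INR p).
Proof. now rewrite plus_INR, RtoC_plus. Qed.

Lemma RtoC_INR_inj n p : RtoC (INR n) = RtoC (INR p) -> n = p.
Proof. intros H. apply INR_eq. now apply RtoC_inj. Qed.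

Lemma INR_S_neq_0 (n : nat) : RtoC (INR n) + 1 <> 0.
Proof.
  rewrite <- RtoC_INR_S. intros H. apply (RtoC_INR_inj _ 0) in H. discriminate.
Qed.

Lemma fact_C_neq_0 n : RtoC (INR (fact n)) <> 0.
Proof. intros H. apply (INR_fact_neq_0 n). now apply RtoC_inj. Qed.

Lemma fact_C_S n : RtoC (INR (fact (S n))) = (n + 1) * fact n.
Proof. now rewrite fact_simpl, mult_INR, RtoC_mult, RtoC_INR_S. Qed.

Ltac field_fact :=
  field; repeat split; try apply fact_C_neq_0; try apply INR_S_neq_0; try assumption.

Lemma poch_S_l z n : poch z (S n) = z * poch (z + 1) n.
Proof.
  induction n as [|n IH]; [simpl; ring|].
  change (poch z (S (S n))) with (poch z (S n) * (z + S n)).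
  rewrite IH. simpl poch. rewrite RtoC_INR_S. ring.
Qed.

Lemma poch_add z n k : poch z (n + k) = poch z n * poch (z + n) k.
Proof.
  induction k as [|k IH].
  - rewrite Nat.add_0_r. simpl. ring.
  - rewrite Nat.add_succ_r. simpl poch. rewrite IH, RtoC_INR_plus. ring.
Qed.

Lemma poch_neq_0 z (n : nat) : (forall i, (i < n)%nat -> z + i <> 0) -> poch z n <> 0.
Proof.
  induction n as [|n IH]; intros H; [exact C1_nz|].
  simpl. apply Cmult_neq_0; [apply IH; intros; apply H; lia|apply H; lia].
Qed.

Lemma poch_neq_0_le z k n : (k <= n)%nat -> poch z n <> 0 -> poch z k <> 0.
Proof.
  intros Hk Hn H. apply Hn. replace n with (k + (n - k))%nat by lia.
  rewrite poch_add, H. ring.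
Qed.

Lemma poch_neq_0_factor z (i n : nat) : (i < n)%nat -> poch z n <> 0 -> z + i <> 0.
Proof.
  intros Hi Hn H. apply (poch_neq_0_le z (S i) n Hi Hn). simpl. rewrite H. ring.
Qed.

Lemma poch_opp_nat_0 (n k : nat) : (n < k)%nat -> poch (- n) k = 0.
Proof.
  intros H. replace k with (n + S (k - n - 1))%nat by lia.
  rewrite poch_add, poch_S_l. ring.
Qed.

Lemma poch_1 n : poch 1 n = RtoC (fact n).
Proof.
  induction n as [|n IH]; [reflexivity|]. rewrite fact_C_S. simpl poch. rewrite IH. ring.
Qed.

Lemma poch_reflect z (n : nat) : poch (1 - z - n) n = (-1) ^ n * poch z n.
Proof.
  revert z. induction n as [|n IH]; intros z; [simpl; ring|].
  rewrite poch_S_l, (poch_S_l z). rewrite RtoC_INR_S.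
  replace (1 - z - (n + 1) + 1) with (1 - z - n) by ring.
  rewrite IH. simpl.
  assert (H : poch z n * (z + n) = z * poch (z + 1) n) by apply (poch_S_l z n).
  transitivity (- ((-1) ^ n * (poch z n * (z + n)))); [ring|].
  rewrite H. ring.
Qed.

Lemma sign_sqr (n : nat) : (-1) ^ n * (-1) ^ n = 1 :> C.
Proof.
  induction n as [|n IH]; simpl; [ring|].
  transitivity ((-1) ^ n * (-1) ^ n); [ring|exact IH].
Qed.

(** Written with n + k and without quotients, so that neither truncated subtraction nor division
    enters; it supplies every (-n)_k in terms of factorials. *)
Lemma poch_opp_nat (n k : nat) : poch (- (n + k)%nat) k * fact n = (-1) ^ k * fact (n + k)%nat.
Proof.
  revert n. induction k as [|k IH]; intros n.
  - rewrite Nat.add_0_r. simpl. ring.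
  - rewrite poch_S_l. specialize (IH n).
    replace (- (n + S k)%nat + 1) with (- (n + k)%nat)
      by (rewrite Nat.add_succ_r, RtoC_INR_S; ring).
    replace (n + S k)%nat with (S (n + k)) by lia.
    rewrite fact_C_S, RtoC_INR_S. simpl.
    transitivity (- ((n + k)%nat + 1) * (poch (- (n + k)%nat) k * fact n)); [ring|].
    rewrite IH. ring.
Qed.

(** * Formal power series *)

(* The coefficients of [(1 - x)^(-s)]. *)
Definition binc (s : C) (n : nat) : C := poch s n / fact n.

(** Sequences stand for formal power series: [conv] is their product, [delay] is multiplication by
    x, and [theta] is x d/dx. *)
Definition conv (u v : nat -> C) (n : nat) : C :=
  sum_n (fun k => u k * v (n - k)%nat) n.

Definition delay (u : nat -> C) (n : nat) : C :=
  match n with O => 0 | S n' => u n' end.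

Lemma conv_ext u u' v v' n :
  (forall k, (k <= n)%nat -> u k = u' k) -> (forall k, (k <= n)%nat -> v k = v' k) ->
  conv u v n = conv u' v' n.
Proof.
  intros Hu Hv. apply csum_ext. intros k Hk. rewrite Hu, Hv by lia. reflexivity.
Qed.

Lemma conv_comm u v n : conv u v n = conv v u n.
Proof.
  unfold conv. rewrite csum_rev. apply csum_ext. intros k Hk.
  replace (n - (n - k))%nat with k by lia. ring.
Qed.

Lemma conv_plus_r u v w n : conv u (fun k => v k + w k) n = conv u v n + conv u w n.
Proof.
  unfold conv. rewrite <- csum_plus. apply csum_ext. intros. ring.
Qed.

Lemma conv_scal_r c u v n : conv u (fun k => c * v k) n = c * conv u v n.
Proof.
  unfold conv. rewrite <- csum_mult_l. apply csum_ext. intros. ring.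
Qed.

Lemma conv_plus_l u v w n : conv (fun k => u k + v k) w n = conv u w n + conv v w n.
Proof. rewrite conv_comm, conv_plus_r. f_equal; apply conv_comm. Qed.

Lemma conv_scal_l c u v n : conv (fun k => c * u k) v n = c * conv u v n.
Proof. rewrite conv_comm, conv_scal_r. f_equal; apply conv_comm. Qed.

Lemma conv_delay_l u v n : conv (delay u) v n = delay (conv u v) n.
Proof.
  unfold conv. destruct n as [|n]; simpl.
  - rewrite csum_O. simpl. ring.
  - rewrite csum_shift. simpl. ring.
Qed.

Lemma conv_delay_r u v n : conv u (delay v) n = delay (conv u v) n.
Proof.
  rewrite conv_comm, conv_delay_l. destruct n; simpl; [reflexivity|apply conv_comm].
Qed.

Lemma conv_assoc u v w n : conv (conv u v) w n = conv u (conv v w) n.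
Proof.
  revert u. induction n as [|n IH]; intros u.
  - unfold conv. rewrite !csum_O. simpl. ring.
  - unfold conv at 1 3. rewrite !csum_shift. simpl Nat.sub.
    (* Splitting off u 0 leaves the same identity for the shifted sequence, one index lower; this is
       why u is generalized. *)
    replace (sum_n (fun k => conv u v (S k) * w (n - k)%nat) n) with
      (u 0%nat * sum_n (fun k => v (S k) * w (n - k)%nat) n +
       conv (conv (fun k => u (S k)) v) w n).
    + rewrite IH. unfold conv at 1. rewrite csum_O. simpl Nat.sub.
      unfold conv at 3. rewrite csum_shift. simpl. unfold conv. ring.
    + unfold conv at 1. rewrite <- csum_mult_l, <- csum_plus.
      apply csum_ext. intros k Hk. unfold conv. rewrite csum_shift. simpl. ring.
Qed.

Definition theta (u : nat -> C) (n : nat) : C := n * u n.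

Lemma theta_conv u v n :
  theta (conv u v) n = conv (theta u) v n + conv u (theta v) n.
Proof.
  unfold theta, conv. rewrite <- csum_mult_l, <- csum_plus. apply csum_ext.
  intros k Hk. replace (RtoC (INR n)) with (RtoC (INR k) + RtoC (INR (n - k)%nat))
    by (rewrite <- RtoC_INR_plus; do 2 f_equal; lia). ring.
Qed.

Lemma binc_0 s : binc s 0 = 1.
Proof. unfold binc. simpl. field. Qed.

Lemma binc_S s (n : nat) : (n + 1) * binc s (S n) = (s + n) * binc s n.
Proof.
  unfold binc. rewrite fact_C_S. simpl poch.
  field. split; [apply fact_C_neq_0|apply INR_S_neq_0].
Qed.

(** For y = (1-x)^(-s) this is the differential equation (1-x) x y' = s x y. *)
Lemma theta_binc s n : theta (binc s) n = delay (fun k => theta (binc s) k + s * binc s k) n.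
Proof.
  destruct n as [|n]; simpl; unfold theta.
  - simpl. ring.
  - rewrite RtoC_INR_S, binc_S. ring.
Qed.

Lemma conv_theta_binc u s n :
  conv u (theta (binc s)) (S n) =
  conv u (theta (binc s)) n + s * conv u (binc s) n.
Proof.
  rewrite (conv_ext u u (theta (binc s)) _ (S n) (fun _ _ => eq_refl)
    (fun k _ => theta_binc s k)).
  rewrite conv_delay_r. simpl. now rewrite conv_plus_r, conv_scal_r.
Qed.

(** The product (1-x)^(-s) (1-x)^(-t). By the Leibniz rule and [theta_binc] it satisfies the
    first-order recurrence of [binc (s + t)]. *)
Lemma vandermonde s t n : conv (binc s) (binc t) n = binc (s + t) n.
Proof.
  induction n as [|n IH].
  - unfold conv. rewrite csum_O. simpl. rewrite !binc_0. ring.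
  - apply (Cmult_eq_reg_l (n + 1)); [apply INR_S_neq_0|].
    rewrite binc_S, <- IH.
    pose proof (theta_conv (binc s) (binc t) (S n)) as H.
    unfold theta at 1 in H. rewrite RtoC_INR_S in H. rewrite H.
    rewrite (conv_comm (theta (binc s))), !conv_theta_binc.
    rewrite (conv_comm (binc t) (theta (binc s))), (conv_comm (binc t) (binc s)).
    pose proof (theta_conv (binc s) (binc t) n) as H'. unfold theta at 1 in H'.
    transitivity (conv (theta (binc s)) (binc t) n + conv (binc s) (theta (binc t)) n
      + (s + t) * conv (binc s) (binc t) n); [ring|].
    rewrite <- H'. ring.
Qed.

(** Multiplication of (1-x)^(-s-1) by 1-x. *)
Lemma binc_diff s n : binc (s + 1) (S n) - binc (s + 1) n = binc s (S n).
Proof.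
  unfold binc. rewrite fact_C_S, (poch_S_l s). simpl poch.
  field. split; [apply fact_C_neq_0|apply INR_S_neq_0].
Qed.

Lemma binc_zero_S n : binc 0 (S n) = 0.
Proof. unfold binc. rewrite poch_S_l. unfold Cdiv. ring. Qed.

(** Multiplying by (1-x)^(-s) and then by (1-x)^s changes nothing; at the end this removes the
    factor (1-x)^(b+m-1). *)
Lemma conv_binc_cancel s u n : conv (binc (- s)) (conv (binc s) u) n = u n.
Proof.
  rewrite <- conv_assoc.
  rewrite (conv_ext _ (binc 0) u u).
  - destruct n as [|n]; unfold conv.
    + rewrite csum_O, binc_0. simpl. ring.
    + rewrite csum_shift, binc_0, csum_zero; [simpl; ring|].
      intros k _. rewrite binc_zero_S. ring.
  - intros k _. rewrite vandermonde. f_equal. ring.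
  - reflexivity.
Qed.

(** [vandermonde] with second parameter 1-c-n: reflection turns its Pochhammer symbols into
    (c+i)_(n-i) = (c)_n/(c)_i up to sign, and n!/(n-i)! is (-n)_i up to sign. *)
Lemma chu_vandermonde b c (n : nat) : poch c n <> 0 ->
  sum_n (fun i => poch (- n) i * poch b i / (poch c i * fact i)) n =
  poch (c - b) n / poch c n :> C.
Proof.
  intros Hc.
  apply (Cmult_eq_reg_l (poch c n / fact n));
    [apply Cmult_neq_0; [exact Hc|apply Cinv_neq_0, fact_C_neq_0]|].
  transitivity ((-1) ^ n * binc (b + (1 - c - n)) n).
  - rewrite <- vandermonde. unfold conv. rewrite <- !csum_mult_l. apply csum_ext.
    intros i Hi. destruct (Nat.le_exists_sub i n Hi) as [l [-> _]].
    replace (l + i - i)%nat with l by lia.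
    pose proof (poch_opp_nat l i) as H1.
    rewrite (Nat.add_comm l i) in *. rewrite poch_add in *.
    pose proof (poch_reflect (c + i) l) as H2.
    replace (1 - (c + i) - l) with (1 - c - (i + l)%nat) in H2
      by (rewrite RtoC_INR_plus; ring).
    unfold binc. rewrite H2.
    assert (H3 : poch (- (i + l)%nat) i = (-1) ^ i * fact (i + l) / fact l).
    { rewrite <- H1. field. apply fact_C_neq_0. }
    rewrite H3, Cpow_add_r. pose proof (sign_sqr l) as H4.
    transitivity (((-1) ^ l * (-1) ^ l) * ((-1) ^ i * poch b i * poch (c + i) l
       / (fact l * fact i))); [rewrite H4|]; field;
      repeat split; try apply fact_C_neq_0; intros H; apply Hc; rewrite H; ring.
  - unfold binc. replace (b + (1 - c - n)) with (1 - (c - b) - n) by ring.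
    rewrite poch_reflect. pose proof (sign_sqr n) as H4.
    transitivity ((-1) ^ n * (-1) ^ n * (poch (c - b) n / fact n));
      [unfold Cdiv; ring|rewrite H4]. field. split; [exact Hc|apply fact_C_neq_0].
Qed.

(** * Coefficients of 2F1(A, B; A + 1; x) times a power of 1 - x *)

Definition hgc (A B : C) (n : nat) : C :=
  poch A n * poch B n / (poch (A + 1) n * fact n).

(** The equation (A + theta) 2F1(A, B; A+1; x) = A (1-x)^(-B), which holds because (A)_n (A+n) = A
    (A+1)_n. *)
Lemma hgc_rec A B n : poch (A + 1) n <> 0 -> (A + n) * hgc A B n = A * binc B n.
Proof.
  intros HA. unfold hgc, binc.
  assert (H : poch A n * (A + n) = A * poch (A + 1) n) by apply (poch_S_l A n).
  transitivity (poch A n * (A + n) * (poch B n / (poch (A + 1) n * fact n)));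
    [field|rewrite H; field]; (split; [apply fact_C_neq_0|exact HA]).
Qed.

(** The equation of [hgc_rec] multiplied by (1-x)^(-s), with the Leibniz rule on the left. *)
Lemma conv_hgc_rec A B s n : poch (A + 1) n <> 0 ->
  (A + n) * conv (hgc A B) (binc s) n =
  A * binc (B + s) n + conv (hgc A B) (theta (binc s)) n.
Proof.
  intros HA. rewrite Cmult_plus_distr_r.
  change (n * conv (hgc A B) (binc s) n) with (theta (conv (hgc A B) (binc s)) n).
  rewrite theta_conv, <- vandermonde, <- conv_scal_l, <- conv_scal_l.
  rewrite Cplus_assoc, <- conv_plus_l. f_equal. apply conv_ext; [|reflexivity].
  intros k Hk. unfold theta. rewrite <- hgc_rec by (eapply poch_neq_0_le; eassumption).
  ring.
Qed.

(* The coefficients of [(1 - x)^(B + p - 1) 2F1(A, B; A + 1; x)], which by Euler's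
   transformation is [(1 - x)^p 2F1(1, A - B + 1; A + 1; x)]. *)
Definition hgcs (A B p : C) : nat -> C := conv (hgc A B) (binc (1 - B - p)).

Lemma hgcs_0 A B p : hgcs A B p 0 = 1.
Proof. unfold hgcs, conv. rewrite csum_O. unfold hgc, binc. simpl. field. Qed.

(** [conv_hgc_rec] at n eliminates the theta term from the one at n+1. The two coefficients of
    (1-x)^(p-1) that remain combine into one of (1-x)^p by [binc_diff]. *)
Lemma hgcs_S A B p n : poch (A + 1) (S n) <> 0 ->
  (A + S n) * hgcs A B p (S n) =
  (A - B - p + S n) * hgcs A B p n + A * binc (- p) (S n).
Proof.
  intros HA. unfold hgcs. rewrite conv_hgc_rec by exact HA.
  rewrite conv_theta_binc.
  assert (H := conv_hgc_rec A B (1 - B - p) n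
    (poch_neq_0_le _ n (S n) (Nat.le_succ_diag_r n) HA)).
  assert (H1 := binc_diff (- p) n).
  replace (B + (1 - B - p)) with (- p + 1) in * by ring.
  rewrite <- H1, RtoC_INR_S.
  set (S0 := conv (hgc A B) (binc (1 - B - p)) n) in *.
  set (T0 := conv (hgc A B) (theta (binc (1 - B - p))) n) in *.
  replace T0 with ((A + n) * S0 - A * binc (- p + 1) n) by (rewrite H; ring).
  ring.
Qed.

(** Partial sums of 2F1(-p, A; D; 1). Here p is any complex number, so the cut at n is a true
    truncation unless p is a natural number with p <= n. *)
Definition gauss_sum (A p D : C) (n : nat) : C :=
  sum_n (fun i => poch (- p) i * poch A i / (poch D i * fact i)) n.

(** (A+1)_n/(A-B-p+1)_n is the summation factor of [hgcs_S]: with it the recurrence says that the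
    increment is the next Gauss term. *)
Lemma hgcs_gauss A B p n :
  poch (A + 1) n <> 0 -> poch (A - B - p + 1) n <> 0 ->
  poch (A + 1) n * hgcs A B p n =
  poch (A - B - p + 1) n * gauss_sum A p (A - B - p + 1) n.
Proof.
  induction n as [|n IH]; intros HA HD.
  - unfold gauss_sum. rewrite hgcs_0, csum_O. simpl. field.
  - assert (HA' := poch_neq_0_le _ n (S n) (Nat.le_succ_diag_r n) HA).
    assert (HD' := poch_neq_0_le _ n (S n) (Nat.le_succ_diag_r n) HD).
    specialize (IH HA' HD').
    assert (H := hgcs_S A B p n HA).
    unfold gauss_sum in *. rewrite csum_S, (Cmult_plus_distr_l (poch _ _)).
    set (T := sum_n _ _) in *.
    transitivity (poch (A + 1) n * ((A + S n) * hgcs A B p (S n))).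
    { simpl poch. rewrite RtoC_INR_S. ring. }
    rewrite H.
    transitivity ((A - B - p + S n) * (poch (A + 1) n * hgcs A B p n) +
                  A * poch (A + 1) n * binc (- p) (S n)); [ring|].
    rewrite IH, <- poch_S_l. unfold binc.
    f_equal; [simpl poch; rewrite RtoC_INR_S; ring|].
    field. split; [apply fact_C_neq_0|exact HD].
Qed.

(** Induction on n: Chu-Vandermonde spreads the new Gauss term over a sum in i of the 3F2 shape,
    after which the step holds for each i separately. *)
Lemma gauss_sum_3F2 A B p n :
  poch (1 - p) n <> 0 -> poch (A - B - p + 1) n <> 0 ->
  gauss_sum A p (A - B - p + 1) n =
  binc (1 - p) n *
  sum_n (fun i => poch (- p) i * poch (- n) i * poch (1 - B - p) i /
    (poch (1 - p) i * poch (A - B - p + 1) i * fact i)) n.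
Proof.
  set (D := A - B - p + 1).
  induction n as [|n IH]; intros Hp HD.
  - unfold gauss_sum. rewrite binc_0, !csum_O. simpl. field.
  - assert (Hp' := poch_neq_0_le _ n (S n) (Nat.le_succ_diag_r n) Hp).
    assert (HD' := poch_neq_0_le _ n (S n) (Nat.le_succ_diag_r n) HD).
    unfold gauss_sum in *. rewrite csum_S, IH by assumption.
    (* (-n)_(n+1) = 0 lets the old sum run to n+1, the range of the new one. *)
    rewrite <- (csum_extend _ n (S n)); [|lia|].
    2: { intros k Hk. rewrite (poch_opp_nat_0 n k) by lia. unfold Cdiv. ring. }
    (* The parameter 1-B-p is forced by D - (1-B-p) = A, so that the value is
       (A)_(n+1)/(D)_(n+1). *)
    assert (Hcv := chu_vandermonde (1 - B - p) D (S n) HD).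
    replace (D - (1 - B - p)) with A in Hcv by (unfold D; ring).
    transitivity (sum_n (fun i => binc (1 - p) n * (poch (- p) i * poch (- n) i *
      poch (1 - B - p) i / (poch (1 - p) i * poch D i * fact i))) (S n) +
      poch (- p) (S n) / fact (S n) * (poch A (S n) / poch D (S n))).
    { rewrite csum_mult_l. f_equal. field. split; [exact HD|apply fact_C_neq_0]. }
    rewrite <- Hcv, <- !csum_mult_l, <- csum_plus. apply csum_ext. intros i Hi.
    assert (Hpi := poch_neq_0_le _ i _ Hi Hp).
    assert (HDi := poch_neq_0_le _ i _ Hi HD).
    unfold binc. rewrite fact_C_S, (poch_S_l (- p)).
    replace (- p + 1) with (1 - p) by ring.
    change (poch (1 - p) (S n)) with (poch (1 - p) n * (1 - p + n)).
    assert (H2 : poch (- S n) i * (- S n + i) = - S n * poch (- S n + 1) i)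
      by apply (poch_S_l (- S n) i).
    replace (- S n + 1) with (- n) in H2 by (rewrite RtoC_INR_S; ring).
    assert (H3 : poch (- p) i * (- p + i) = - p * poch (1 - p) i).
    { replace (1 - p) with (- p + 1) by ring. apply (poch_S_l (- p) i). }
    apply (Cmult_eq_reg_l (poch (1 - p) i * (n + 1)));
      [apply Cmult_neq_0; [exact Hpi|apply INR_S_neq_0]|].
    pose proof (INR_S_neq_0 n) as Hn.
    transitivity (poch (1 - p) n * poch (1 - B - p) i /
      (poch D i * fact i * fact n) *
      (poch (- p) i * ((n + 1) * poch (- n) i)
        - p * poch (1 - p) i * poch (- S n) i)).
    { field. repeat split; try apply fact_C_neq_0; assumption. }
    (* Everything is brought to (-n-1)_i; together with [H3], which relates (-p)_i and (1-p)_i, only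
       a rational identity is left. *)
    replace ((n + 1) * poch (- n) i) with (poch (- S n) i * (n + 1 - i)).
    2: { transitivity (- (poch (- S n) i * (- S n + i)));
         [|rewrite H2]; rewrite RtoC_INR_S; ring. }
    transitivity (poch (1 - p) n * poch (1 - B - p) i /
      (poch D i * fact i * fact n) * poch (- S n) i *
      (poch (- p) i * (n + 1 - i) + (- p * poch (1 - p) i))); [ring|].
    rewrite <- H3.
    field. repeat split; try apply fact_C_neq_0; assumption.
Qed.

(** For natural p the Gauss sum stopped at p is complete, and Chu-Vandermonde gives its value. *)
Lemma hgcs_diag A B (p : nat) :
  poch (A + 1) p <> 0 -> poch (A - B - p + 1) p <> 0 ->
  hgcs A B p p = (-1) ^ p * poch B p / poch (A + 1) p.
Proof.
  intros HA HD. apply (Cmult_eq_reg_l (poch (A + 1) p)); [exact HA|].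
  rewrite hgcs_gauss by assumption. unfold gauss_sum.
  rewrite chu_vandermonde by exact HD.
  replace (A - B - p + 1 - A) with (1 - B - p) by ring.
  rewrite poch_reflect. field. split; assumption.
Qed.

(** Past p the recurrence is homogeneous, with ratio (A-B+l+1)/(A+p+l+1). No condition on A-B is
    imposed; with p = 0 this is Euler's transformation, used again in [euler_continuation]. *)
Lemma hgcs_tail A B (p l : nat) : poch (A + 1) (p + l) <> 0 ->
  hgcs A B p (p + l) = hgcs A B p p * poch (A - B + 1) l / poch (A + p + 1) l.
Proof.
  induction l as [|l IH]; intros HA.
  - rewrite Nat.add_0_r. simpl. field.
  - rewrite Nat.add_succ_r in *.
    assert (HA' := poch_neq_0_le _ (p + l) (S (p + l)) (Nat.le_succ_diag_r _) HA).
    assert (Hl : poch (A + p + 1) l <> 0).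
    { intros H. apply HA'. rewrite poch_add.
      replace (A + 1 + p) with (A + p + 1) by ring. rewrite H. ring. }
    assert (Hf : A + p + l + 1 <> 0).
    { intros H. apply (poch_neq_0_factor _ _ _ (Nat.lt_succ_diag_r _) HA).
      rewrite RtoC_INR_plus, <- H. ring. }
    apply (Cmult_eq_reg_l (A + S (p + l))).
    { rewrite RtoC_INR_S, RtoC_INR_plus. intros H. apply Hf. rewrite <- H. ring. }
    rewrite hgcs_S, IH by assumption. unfold binc at 1.
    rewrite poch_opp_nat_0 by lia. simpl poch.
    rewrite RtoC_INR_S, RtoC_INR_plus.
    field. repeat split; try assumption; try apply fact_C_neq_0;
      intros H; apply Hf; rewrite <- H; ring.
Qed.

(** * Newton expansion of the weight polynomial *)

(** z (z-1) ... (z-k+1), written with [poch] because it is evaluated at natural numbers and at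
    -a. *)
Definition falling (z : C) (k : nat) : C := (-1) ^ k * poch (- z) k.

(* The coefficients of a polynomial function in the basis of falling factorials. *)
Definition newton_coef (V : C -> C) (k : nat) : C :=
  sum_n (fun i => (-1) ^ k * (-1) ^ i * V i / (fact i * fact (k - i)%nat)) k.

(** Polynomial of degree at most m, for a function known only by its values. The second clause is
    what makes the index shift in [newton_deg_factor] possible. *)
Definition newton_deg (V : C -> C) (m : nat) : Prop :=
  (forall z, V z = sum_n (fun k => newton_coef V k * falling z k) m) /\
  (forall k, (m < k)%nat -> newton_coef V k = 0).

Lemma falling_S z k : falling z (S k) = falling z k * (z - k).
Proof. unfold falling. simpl. ring. Qed.

Lemma newton_coef_ext V W k : (forall z, V z = W z) -> newton_coef V k = newton_coef W k.
Proof. intros H. apply csum_ext. intros. now rewrite H. Qed.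

Lemma newton_coef_scal c V k : newton_coef (fun z => c * V z) k = c * newton_coef V k.
Proof.
  unfold newton_coef. rewrite <- csum_mult_l. apply csum_ext. intros.
  unfold Cdiv. ring.
Qed.

Lemma newton_coef_0 V : newton_coef V 0 = V (RtoC 0).
Proof. unfold newton_coef. rewrite csum_O. simpl. field. Qed.

Lemma newton_coef_const_S c k : newton_coef (fun _ => c) (S k) = 0.
Proof.
  unfold newton_coef.
  (* Up to a constant factor, the partial sums of (-1)^i binom(k+1, i) are (-1)^n binom(k, n); the
     one for n = k cancels the last term of the full sum. *)
  assert (H : forall n, (n <= k)%nat ->
    sum_n (fun i => (-1) ^ S k * (-1) ^ i * c / (fact i * fact (S k - i)%nat)) n
    = (-1) ^ S k * (-1) ^ n * c / (fact n * fact (k - n)%nat * (k + 1)) :> C).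
  { induction n as [|n IH]; intros Hn.
    - rewrite csum_O, !Nat.sub_0_r, fact_C_S. simpl.
      field_fact.
    - rewrite csum_S, IH by lia.
      replace k with (n + S (k - n - 1))%nat by lia. set (l := (k - n - 1)%nat).
      replace (n + S l - n)%nat with (S l) by lia.
      replace (S (n + S l) - S n)%nat with (S l) by lia.
      replace (n + S l - S n)%nat with l by lia.
      rewrite !fact_C_S, !RtoC_INR_plus, !RtoC_INR_S.
      pose proof (INR_S_neq_0 (n + S l)) as H.
      rewrite RtoC_INR_plus, RtoC_INR_S in H.
      rewrite (Cpow_S _ n).
      field. repeat split; try apply fact_C_neq_0; try apply INR_S_neq_0; exact H. }
  rewrite csum_S, H, Nat.sub_diag by lia.
  replace (S k - S k)%nat with 0%nat by lia. rewrite fact_C_S.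
  rewrite (Cpow_S _ k). simpl.
  field_fact.
Qed.

(** Reflects (z+r) = (z-k) + (r+k) applied to the basis. On the explicit sums, i + r = (r+k+1) -
    (k+1-i), and the second part cancels a factor of (k+1-i)!. *)
Lemma newton_coef_factor_S V r k :
  newton_coef (fun z => V z * (z + r)) (S k) =
  (r + S k) * newton_coef V (S k) + newton_coef V k.
Proof.
  unfold newton_coef.
  rewrite !csum_S, (Cmult_plus_distr_l (r + S k)), <- csum_mult_l.
  transitivity (sum_n (fun i => (r + S k) * ((-1) ^ S k * (-1) ^ i * V i /
      (fact i * fact (S k - i)%nat)) + (-1) ^ k * (-1) ^ i * V i /
      (fact i * fact (k - i)%nat)) k + (r + S k) *
      ((-1) ^ S k * (-1) ^ S k * V (S k) / (fact (S k) * fact (S k - S k)%nat)) : C).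
  - f_equal.
    + apply csum_ext. intros i Hi.
      replace k with (i + (k - i))%nat by lia. set (l := (k - i)%nat).
      replace (S (i + l) - i)%nat with (S l) by lia.
      replace (i + l - i)%nat with l by lia.
      rewrite !fact_C_S, !RtoC_INR_S, RtoC_INR_plus, (Cpow_S _ (i + l)).
      field. repeat split; try apply fact_C_neq_0; apply INR_S_neq_0.
    + unfold Cdiv. ring.
  - rewrite csum_plus. ring.
Qed.

Lemma newton_deg_const c : newton_deg (fun _ => c) 0.
Proof.
  split.
  - intros z. rewrite csum_O, newton_coef_0. unfold falling. simpl. ring.
  - intros [|k] Hk; [lia|apply newton_coef_const_S].
Qed.

Lemma newton_deg_factor V r m :
  newton_deg V m -> newton_deg (fun z => V z * (z + r)) (S m).
Proof.
  intros [H0 H1]. split.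
  - intros z. rewrite H0, csum_shift, newton_coef_0.
    rewrite (csum_ext (fun k => newton_coef _ (S k) * falling z (S k))
      (fun k => (r + S k) * newton_coef V (S k) * falling z (S k)
      + newton_coef V k * falling z k * (z - k))).
    2: { intros k _. rewrite newton_coef_factor_S, falling_S. ring. }
    rewrite csum_plus.
    (* Shifting the index back needs the term at m+1, which vanishes, and produces the term r V(0)
       at k = 0. *)
    assert (H2 := csum_shift (fun k => (r + k) * newton_coef V k * falling z k) m).
    rewrite csum_S, H1 in H2 by lia.
    set (S1 := sum_n (fun k => (r + S k) * _ * _) m) in *.
    assert (H3 : S1 = sum_n (fun k => (r + k) * newton_coef V k * falling z k) m
      - r * V (RtoC 0) :> C).
    { transitivity ((r + 0%nat) * newton_coef V 0 * falling z 0 + S1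
        - r * V (RtoC 0)); [rewrite newton_coef_0; unfold falling; simpl; symmetry; ring|].
      rewrite <- H2. ring. }
    rewrite H3. rewrite Cmult_comm, <- csum_mult_l.
    transitivity (sum_n (fun k => (r + k) * newton_coef V k * falling z k) m +
      sum_n (fun k => newton_coef V k * falling z k * (z - k)) m : C).
    + rewrite <- csum_plus. apply csum_ext. intros. ring.
    + unfold falling. simpl. ring.
  - intros [|k] Hk; [lia|]. rewrite newton_coef_factor_S, !H1 by lia. ring.
Qed.

Lemma newton_deg_ext V W m : (forall z, V z = W z) -> newton_deg V m -> newton_deg W m.
Proof.
  intros H [H0 H1]. split.
  - intros z. rewrite <- H, H0. apply csum_ext. intros k _. f_equal.
    now apply newton_coef_ext.
  - intros k Hk. rewrite <- (H1 k Hk). symmetry. now apply newton_coef_ext.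
Qed.

Lemma newton_deg_scal c V m : newton_deg V m -> newton_deg (fun z => c * V z) m.
Proof.
  intros [H0 H1]. split.
  - intros z. rewrite H0, <- csum_mult_l. apply csum_ext. intros k _.
    rewrite newton_coef_scal. ring.
  - intros k Hk. rewrite newton_coef_scal, H1 by exact Hk. ring.
Qed.

Lemma newton_deg_poch V f m n :
  newton_deg V m -> newton_deg (fun z => V z * poch (f + z) n) (m + n).
Proof.
  intros HV. induction n as [|n IH].
  - rewrite Nat.add_0_r. revert HV. apply newton_deg_ext. intros. simpl. ring.
  - rewrite Nat.add_succ_r.
    apply (newton_deg_ext (fun z => V z * poch (f + z) n * (z + (f + n)))).
    + intros. simpl. ring.
    + now apply newton_deg_factor.
Qed.

Lemma vpoch_shift_cons f0 f mv0 mv z :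
  vpoch (shift (f0 :: f) z) (mv0 :: mv) = poch (f0 + z) mv0 * vpoch (shift f z) mv.
Proof. reflexivity. Qed.

Lemma newton_deg_vpoch f mv : length f = length mv ->
  newton_deg (fun z => vpoch (shift f z) mv) (list_sum mv).
Proof.
  revert mv. induction f as [|f0 f IH]; intros [|m0 mv] Hl; try discriminate.
  - exact (newton_deg_const 1).
  - simpl list_sum. rewrite Nat.add_comm.
    apply (newton_deg_ext (fun z => vpoch (shift f z) mv * poch (f0 + z) m0)).
    + intros z. rewrite vpoch_shift_cons. ring.
    + apply newton_deg_poch, IH. now injection Hl.
Qed.

Lemma nonpos_int_poch z n : ~ nonpos_int z -> poch z n <> 0.
Proof.
  intros Hz. apply poch_neq_0. intros i _ H. apply Hz. exists i.
  transitivity (z + i - i); [ring|rewrite H; ring].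
Qed.

Definition Cprod_poch (f : list C) (n : nat) : C := Cprod (map (fun z => poch z n) f).

Lemma Cprod_poch_neq_0 f n : Forall (fun fj => ~ nonpos_int fj) f -> Cprod_poch f n <> 0.
Proof.
  induction 1 as [|f0 f H0 H IH]; [exact C1_nz|].
  apply Cmult_neq_0; [now apply nonpos_int_poch|exact IH].
Qed.

Lemma vpoch_neq_0 f mv : Forall (fun fj => ~ nonpos_int fj) f -> vpoch f mv <> 0.
Proof.
  intros H. revert mv. induction H as [|f0 f H0 H IH]; intros [|m0 mv]; try exact C1_nz.
  apply Cmult_neq_0; [now apply nonpos_int_poch|apply IH].
Qed.

(** Factor by factor, both sides are (f_j)_(m_j+n). Thus (f+m)_n/(f)_n depends polynomially on n. *)
Lemma vshift_ratio f mv (n : nat) : length f = length mv ->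
  Cprod_poch (vshift f mv) n * vpoch f mv =
  vpoch (shift f n) mv * Cprod_poch f n.
Proof.
  revert mv. induction f as [|f0 f IH]; intros [|m0 mv] Hl; try discriminate; [reflexivity|].
  injection Hl as Hl. specialize (IH mv Hl).
  rewrite vpoch_shift_cons.
  change (Cprod_poch (vshift (f0 :: f) (m0 :: mv)) n) with
    (poch (f0 + m0) n * Cprod_poch (vshift f mv) n).
  change (vpoch (f0 :: f) (m0 :: mv)) with (poch f0 m0 * vpoch f mv).
  change (Cprod_poch (f0 :: f) n) with (poch f0 n * Cprod_poch f n).
  transitivity (poch f0 m0 * poch (f0 + m0) n * (Cprod_poch (vshift f mv) n * vpoch f mv));
    [ring|].
  rewrite IH, <- poch_add, (Nat.add_comm m0 n), poch_add. ring.
Qed.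

(** Its value at n is (f+m)_n/(f)_n, and its value at -a is (f-a)_m/(f)_m. *)
Definition weight_poly (f : list C) (mv : list nat) (z : C) : C :=
  / vpoch f mv * vpoch (shift f z) mv.

(** Since (-k)_i = (-1)^i k!/(k-i)!, the sum defining C_{k,r} is a k-th finite difference at 0
    divided by k!. *)
Lemma Ccoef_newton f mv k : length f = length mv ->
  Forall (fun fj => ~ nonpos_int fj) f ->
  Ccoef f mv k = newton_coef (weight_poly f mv) k.
Proof.
  intros Hl Hf. unfold Ccoef, hyp_sum, newton_coef. rewrite <- csum_mult_l.
  apply csum_ext. intros i Hi. unfold weight_poly, hyp_coef.
  change (Cprod (map (fun z => poch z i) (- k :: vshift f mv))) with
    (poch (- k) i * Cprod_poch (vshift f mv) i).
  fold (Cprod_poch f i).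
  assert (H := vshift_ratio f mv i Hl).
  assert (Hv := vpoch_neq_0 f mv Hf). assert (HP := Cprod_poch_neq_0 f i Hf).
  replace (Cprod_poch (vshift f mv) i) with
    (vpoch (shift f i) mv * Cprod_poch f i / vpoch f mv)
    by (rewrite <- H; field; exact Hv).
  rewrite Cpow_1_l.
  destruct (Nat.le_exists_sub i k Hi) as [l [-> _]].
  replace (l + i - i)%nat with l by lia.
  assert (H1 := poch_opp_nat l i).
  replace (poch (- (l + i)%nat) i) with ((-1) ^ i * fact (l + i) / fact l)
    by (rewrite <- H1; field; apply fact_C_neq_0).
  field. repeat split; try assumption; apply fact_C_neq_0.
Qed.

Lemma weight_poly_expand f mv z : length f = length mv ->
  Forall (fun fj => ~ nonpos_int fj) f ->
  weight_poly f mv z =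
  sum_n (fun k => Ccoef f mv k * falling z k) (list_sum mv).
Proof.
  intros Hl Hf.
  destruct (newton_deg_scal (/ vpoch f mv) _ _ (newton_deg_vpoch f mv Hl)) as [H _].
  unfold weight_poly at 1. rewrite H. apply csum_ext. intros k _.
  now rewrite Ccoef_newton.
Qed.

(** * The coefficients of the two sides *)

(** Multiplication by x^k. *)
Definition ndelay (k : nat) (u : nat -> C) (n : nat) : C :=
  if (k <=? n)%nat then u (n - k)%nat else 0.

Lemma ndelay_ge k u n : ndelay k u (k + n)%nat = u n.
Proof.
  unfold ndelay. destruct (Nat.leb_spec k (k + n)); [|lia]. f_equal. lia.
Qed.

Lemma ndelay_lt k u n : (n < k)%nat -> ndelay k u n = 0.
Proof. intros H. unfold ndelay. destruct (Nat.leb_spec k n); [lia|reflexivity]. Qed.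

Lemma ndelay_S k u n : ndelay (S k) u n = delay (ndelay k u) n.
Proof. destruct n; reflexivity. Qed.

Lemma conv_ndelay_r u k v n : conv u (ndelay k v) n = ndelay k (conv u v) n.
Proof.
  revert n. induction k as [|k IH]; intros n.
  - unfold ndelay at 2. simpl. rewrite Nat.sub_0_r. apply conv_ext; [reflexivity|].
    intros i _. unfold ndelay. simpl. now rewrite Nat.sub_0_r.
  - rewrite ndelay_S, (conv_ext _ u _ (delay (ndelay k v))); [|reflexivity|].
    + rewrite conv_delay_r. destruct n; [reflexivity|apply IH].
    + intros. apply ndelay_S.
Qed.

Lemma conv_sum_r u c (v : nat -> nat -> C) m n :
  conv u (fun i => sum_n (fun k => c k * v k i) m) n =
  sum_n (fun k => c k * conv u (v k) n) m.
Proof.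
  unfold conv.
  transitivity (sum_n (fun i => sum_n (fun k => c k * (u i * v k (n - i)%nat)) m) n : C).
  - apply csum_ext. intros i _. rewrite <- csum_mult_l. apply csum_ext. intros. ring.
  - rewrite csum_switch. apply csum_ext. intros k _. now rewrite csum_mult_l.
Qed.

Definition split_weight (a b : C) (f : list C) (mv : list nat) (k : nat) : C :=
  Ccoef f mv k * (poch a k * poch b k / poch (a + 1) k).

(** The falling factorial n!/(n-k)! of the Newton expansion cancels n! and leaves (n-k)!, while each
    (z)_n splits as (z)_k (z+k)_(n-k). It vanishes for n < k, hence the factor x^k. *)
Lemma hyp_coef_split a b f mv n : length f = length mv ->
  Forall (fun fj => ~ nonpos_int fj) f -> ~ nonpos_int (a + 1) ->
  hyp_coef (a :: b :: vshift f mv) (a + 1 :: f) n =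
  sum_n (fun k => split_weight a b f mv k *
    ndelay k (hgc (a + k) (b + k)) n) (list_sum mv).
Proof.
  intros Hl Hf Ha.
  transitivity (hgc a b n * weight_poly f mv n).
  - unfold hyp_coef, hgc, weight_poly.
    change (Cprod (map (fun z => poch z n) (a :: b :: vshift f mv))) with
      (poch a n * (poch b n * Cprod_poch (vshift f mv) n)).
    change (Cprod (map (fun z => poch z n) (a + 1 :: f))) with
      (poch (a + 1) n * Cprod_poch f n).
    assert (H := vshift_ratio f mv n Hl).
    assert (Hv := vpoch_neq_0 f mv Hf). assert (HP := Cprod_poch_neq_0 f n Hf).
    assert (Han := nonpos_int_poch _ n Ha).
    replace (Cprod_poch (vshift f mv) n) with
      (vpoch (shift f n) mv * Cprod_poch f n / vpoch f mv)
      by (rewrite <- H; field; exact Hv).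
    field_fact.
  - rewrite weight_poly_expand, <- csum_mult_l by assumption.
    apply csum_ext. intros k _. unfold split_weight.
    transitivity (Ccoef f mv k * (hgc a b n * falling n k)); [ring|].
    rewrite <- Cmult_assoc. f_equal.
    destruct (Nat.lt_ge_cases n k) as [Hk|Hk].
    + rewrite ndelay_lt by exact Hk. unfold falling.
      rewrite poch_opp_nat_0 by exact Hk. ring.
    + replace n with (k + (n - k))%nat by lia. set (l := (n - k)%nat).
      rewrite ndelay_ge. unfold hgc, falling.
      assert (H := poch_opp_nat l k). rewrite (Nat.add_comm l k) in H.
      replace (poch (- (k + l)%nat) k) with ((-1) ^ k * fact (k + l) / fact l)
        by (rewrite <- H; field_fact).
      assert (Hk0 := nonpos_int_poch _ k Ha).
      assert (Hkl := nonpos_int_poch _ (k + l) Ha).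
      rewrite !poch_add in *. replace (a + k + 1) with (a + 1 + k) by ring.
      assert (Hl0 : poch (a + 1 + k) l <> 0) by (intros E; apply Hkl; rewrite E; ring).
      transitivity ((-1) ^ k * (-1) ^ k * (poch a k * poch b k / poch (a + 1) k *
        (poch (a + k) l * poch (b + k) l / (poch (a + 1 + k) l * fact l))));
        [field_fact|rewrite sign_sqr; ring].
Qed.

(** One power of 1-x serves every summand because b+m-1 = (b+k) + (m-k) - 1; this dictates p = m-k
    in [hgcs]. *)
Lemma conv_hyp_coef a b f mv (m : nat) n : m = list_sum mv -> length f = length mv ->
  Forall (fun fj => ~ nonpos_int fj) f -> ~ nonpos_int (a + 1) ->
  conv (binc (1 - b - m)) (hyp_coef (a :: b :: vshift f mv) (a + 1 :: f)) n =
  sum_n (fun k => split_weight a b f mv k *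
    ndelay k (hgcs (a + k) (b + k) (m - k)) n) m.
Proof.
  intros Hm Hl Hf Ha.
  rewrite (conv_ext _ (binc (1 - b - m)) _ (fun i => sum_n (fun k =>
    split_weight a b f mv k * ndelay k (hgc (a + k) (b + k)) i) m)); [|reflexivity|].
  - rewrite conv_sum_r. apply csum_ext. intros k _. f_equal.
    rewrite conv_ndelay_r. unfold ndelay. destruct (k <=? n)%nat; [|reflexivity].
    rewrite conv_comm. apply conv_ext; [reflexivity|]. intros i _. f_equal. ring.
  - intros i _. rewrite Hm. now apply hyp_coef_split.
Qed.

(** Factor i of the symbol is a-b-(m-1-i). *)
Lemma poch_sub_neq_0 (a b : C) (m : nat) :
  (forall i : nat, (i < m)%nat -> a - b <> i) -> poch (a - b - m + 1) m <> 0.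
Proof.
  intros H. apply poch_neq_0. intros i Hi E. apply (H (m - 1 - i)%nat); [lia|].
  assert (Hm : RtoC (INR m) = (m - 1 - i)%nat + i + 1).
  { rewrite <- RtoC_INR_plus, <- RtoC_INR_S. do 2 f_equal. lia. }
  transitivity (a - b - m + 1 + i + ((m - 1 - i)%nat)); [rewrite Hm; ring|].
  rewrite E. ring.
Qed.

Lemma poch_one_sub_neq_0 (m n : nat) : (n < m)%nat -> poch (1 - m) n <> 0.
Proof.
  intros H. apply poch_neq_0. intros i Hi E.
  apply (INR_S_neq_0 (m - 2 - i)).
  assert (Hm : RtoC (INR m) = (m - 2 - i)%nat + i + 2).
  { transitivity (RtoC (INR (m - 2 - i + i + 2))); [do 2 f_equal; lia|].
    rewrite !RtoC_INR_plus. simpl. rewrite RtoC_plus. ring. }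
  transitivity (- (1 - m + i)); [rewrite Hm; ring|rewrite E; ring].
Qed.

(** [hgcs_gauss] and [gauss_sum_3F2] at index j-k, with A = a+k, B = b+k, p = m-k. The bound j < m
    keeps (1-p)_(j-k) away from 0. *)
Lemma low_coef a b f mv (m j : nat) : (j < m)%nat ->
  ~ nonpos_int (a + 1) -> poch (a - b - m + 1) m <> 0 ->
  sum_n (fun k => split_weight a b f mv k *
    ndelay k (hgcs (a + k) (b + k) (m - k)) j) m =
  poch (1 - m) j * poch (a - b - m + 1) j / (poch (a + 1) j * fact j) *
    Qhat0 a b f mv m j :> C.
Proof.
  intros Hj Ha HD. rewrite (csum_extend _ j m); [|lia|].
  2: { intros k Hk. rewrite ndelay_lt by lia. ring. }
  unfold Qhat0. rewrite <- csum_mult_l. apply csum_ext. intros k Hk.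
  assert (H1 := poch_one_sub_neq_0 m j Hj).
  apply (poch_neq_0_le _ j) in HD; [|lia].
  assert (Haj := nonpos_int_poch _ j Ha).
  (* Replacing j by k+l makes every symbol of length j split as one of length k times one of length
     l. *)
  assert (E : j = (k + (j - k))%nat) by lia. remember (j - k)%nat as l eqn:El.
  clear El Hk. subst j. rewrite ndelay_ge.
  assert (Hk := poch_opp_nat l k). rewrite (Nat.add_comm l k) in Hk.
  rewrite !poch_add in *.
  assert (H1k : poch (1 - m) k <> 0) by (intros E; apply H1; rewrite E; ring).
  assert (H1l : poch (1 - m + k) l <> 0) by (intros E; apply H1; rewrite E; ring).
  assert (HDk : poch (a - b - m + 1) k <> 0) by (intros E; apply HD; rewrite E; ring).
  assert (HDl : poch (a - b - m + 1 + k) l <> 0) by (intros E; apply HD; rewrite E; ring).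
  assert (Hak : poch (a + 1) k <> 0) by (intros E; apply Haj; rewrite E; ring).
  assert (Hal : poch (a + 1 + k) l <> 0) by (intros E; apply Haj; rewrite E; ring).
  assert (Hg := hgcs_gauss (a + k) (b + k) (m - k) l).
  assert (Hf := gauss_sum_3F2 (a + k) (b + k) (m - k) l).
  replace (a + k - (b + k) - (m - k) + 1) with (a - b - m + 1 + k) in * by ring.
  replace (1 - (m - k)) with (1 - m + k) in * by ring.
  replace (a + k + 1) with (a + 1 + k) in * by ring.
  specialize (Hg Hal HDl). specialize (Hf H1l HDl). rewrite Hf in Hg.
  match type of Hg with _ = _ * (_ * ?s) => set (S1 := s) in * end.
  replace (hyp_sum l _ _ 1) with S1.
  2: { apply csum_ext. intros i _. unfold hyp_coef. rewrite Cpow_1_l. cbn [map Cprod fold_right].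
    replace (- (m - k)) with (k - m) by ring.
    replace (k - (k + l)%nat) with (- l) by (rewrite RtoC_INR_plus; ring).
    replace (1 - (b + k) - (m - k)) with (1 - b - m) by ring.
    replace (k - m + 1) with (1 - m + k) by ring.
    replace (a - b - m + k + 1) with (a - b - m + 1 + k) by ring.
    rewrite !Cmult_1_r. now rewrite !Cmult_assoc. }
  unfold split_weight.
  replace (hgcs (a + k) (b + k) (m - k) l) with
    (poch (a - b - m + 1 + k) l * (binc (1 - m + k) l * S1) / poch (a + 1 + k) l)
    by (rewrite <- Hg; field; exact Hal).
  unfold binc.
  replace (poch (- (k + l)%nat) k) with ((-1) ^ k * fact (k + l) / fact l)
    by (rewrite <- Hk; field_fact).
  clearbody S1. change C in S1.
  transitivity ((-1) ^ k * (-1) ^ k * (Ccoef f mv k * (poch a k * poch b k / poch (a + 1) k) *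
    (poch (a - b - m + 1 + k) l * (poch (1 - m + k) l / fact l * S1) / poch (a + 1 + k) l)));
    [rewrite sign_sqr; ring|field_fact].
Qed.

(** In [hgcs_tail] the quotient that depends on l involves only A-B = a-b and A+p = a+m, so it is
    common to all k. The rest of the sum is the Newton expansion of [weight_poly] at -a. *)
Lemma high_coef a b f mv (m l : nat) : m = list_sum mv -> length f = length mv ->
  Forall (fun fj => ~ nonpos_int fj) f ->
  ~ nonpos_int (a + 1) -> poch (a - b - m + 1) m <> 0 ->
  sum_n (fun k => split_weight a b f mv k *
    ndelay k (hgcs (a + k) (b + k) (m - k)) (m + l)%nat) m =
  (-1) ^ m * poch b m * vpoch (shift f (- a)) mv / (poch (a + 1) m * vpoch f mv) *
    hyp_coef (RtoC 1 :: 1 - b + a :: nil) (a + m + 1 :: nil) l :> C.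
Proof.
  intros Hm Hlen Hf Ha HD.
  assert (Hw := weight_poly_expand f mv (- a) Hlen Hf). rewrite <- Hm in Hw.
  assert (Hv := vpoch_neq_0 f mv Hf).
  assert (Haml := nonpos_int_poch _ (m + l) Ha). rewrite poch_add in Haml.
  assert (Ham : poch (a + 1) m <> 0) by (intros E; apply Haml; rewrite E; ring).
  assert (Hal : poch (a + 1 + m) l <> 0) by (intros E; apply Haml; rewrite E; ring).
  transitivity ((-1) ^ m * poch b m / poch (a + 1) m *
    (poch (1 - b + a) l / poch (a + 1 + m) l) * weight_poly f mv (- a)).
  - rewrite Hw, <- csum_mult_l. apply csum_ext. intros k Hk.
    assert (E : m = (k + (m - k))%nat) by lia. remember (m - k)%nat as p eqn:Ep.
    clear Ep Hk Hm Hw. subst m.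
    replace (k + p + l)%nat with (k + (p + l))%nat by lia. rewrite ndelay_ge.
    (* The complex difference m-k becomes a natural number, as [hgcs_tail] and [hgcs_diag]
       require. *)
    replace ((k + p)%nat - k) with (RtoC (INR p)) by (rewrite RtoC_INR_plus; ring).
    assert (Hkp : poch (a + k + 1) (p + l) <> 0).
    { intros H0. apply Haml.
      rewrite <- poch_add, <- Nat.add_assoc, poch_add.
      replace (a + 1 + k) with (a + k + 1) by ring. rewrite H0. ring. }
    rewrite hgcs_tail by exact Hkp.
    rewrite hgcs_diag.
    + unfold split_weight, falling. replace (- - a) with a by ring. rewrite Cpow_add_r.
      replace (a + k - (b + k) + 1) with (1 - b + a) by ring.
      replace (a + k + p + 1) with (a + 1 + (k + p)%nat) by (rewrite RtoC_INR_plus; ring).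
      rewrite poch_add, (poch_add (a + 1) k p) in *.
      replace (a + 1 + k) with (a + k + 1) in * by ring.
      assert (Hak : poch (a + 1) k <> 0) by (intros E; apply Ham; rewrite E; ring).
      assert (Hap : poch (a + k + 1) p <> 0) by (intros E; apply Ham; rewrite E; ring).
      transitivity ((-1) ^ k * (-1) ^ k * (Ccoef f mv k * (poch a k * poch b k / poch (a + 1) k) *
        ((-1) ^ p * poch (b + k) p / poch (a + k + 1) p * poch (1 - b + a) l
          / poch (a + 1 + (k + p)%nat) l))); [rewrite sign_sqr; ring|field_fact].
    + apply (poch_neq_0_le _ p (p + l)); [lia|exact Hkp].
    + intros H0. apply HD. rewrite poch_add.
      replace (a - b - (k + p)%nat + 1 + k) with (a + k - (b + k) - p + 1)
        by (rewrite RtoC_INR_plus; ring).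
      rewrite H0. ring.
  - unfold weight_poly, hyp_coef. cbn [map Cprod fold_right].
    replace (a + m + 1) with (a + 1 + m) by ring.
    rewrite poch_1. field_fact.
Qed.

(** * Complex power series and analytic functions *)

(** Convergence by coordinates gives access to the theory of real series; [C_pseries_iff] relates it
    to the notion of the statement. *)
Definition Cser (u : nat -> C) (l : C) : Prop :=
  is_series (fun n => fst (u n)) (fst l) /\ is_series (fun n => snd (u n)) (snd l).

Lemma fst_csum (u : nat -> C) n : fst (sum_n u n : C) = sum_n (fun k => fst (u k)) n.
Proof.
  induction n as [|n IH]; [now rewrite !sum_O|].
  rewrite !sum_Sn, <- IH. reflexivity.
Qed.

Lemma snd_csum (u : nat -> C) n : snd (sum_n u n : C) = sum_n (fun k => snd (u k)) n.
Proof.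
  induction n as [|n IH]; [now rewrite !sum_O|].
  rewrite !sum_Sn, <- IH. reflexivity.
Qed.

Lemma pow_n_Cpow (z : C) n : @pow_n C_AbsRing z n = z ^ n.
Proof. induction n as [|n IH]; [reflexivity|]. simpl. now rewrite <- IH. Qed.

Lemma C_pseries_iff c z l : C_pseries c z l <-> Cser (fun n => c n * z ^ n) l.
Proof.
  assert (E : forall n, @sum_n C_AbelianMonoid (fun k => scal (@pow_n C_AbsRing z k) (c k)) n
    = @sum_n C_AbelianMonoid (fun k => c k * z ^ k) n).
  { intros n. apply csum_ext. intros k _. rewrite pow_n_Cpow. apply Cmult_comm. }
  unfold C_pseries, is_pseries, Cser, is_series. split.
  - intros H. split; apply filterlim_locally; intros eps;
      generalize (proj1 (filterlim_locally _ _) H eps); apply filter_imp; intros n [H1 H2].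
    + rewrite <- fst_csum. simpl in E. rewrite <- E. exact H1.
    + rewrite <- snd_csum. simpl in E. rewrite <- E. exact H2.
  - intros [H1 H2]. apply filterlim_locally. intros eps.
    generalize (filter_and _ _ (proj1 (filterlim_locally _ _) H1 eps)
      (proj1 (filterlim_locally _ _) H2 eps)).
    apply filter_imp. intros n [B1 B2].
    rewrite <- fst_csum in B1. rewrite <- snd_csum in B2.
    simpl in E. rewrite <- E in B1, B2. split; assumption.
Qed.

Lemma Cser_unique u l l' : Cser u l -> Cser u l' -> l = l'.
Proof.
  intros [H1 H2] [H1' H2'].
  apply is_series_unique in H1, H2, H1', H2'.
  destruct l, l'; simpl in *. congruence.
Qed.

Lemma Cser_ext u v l : (forall n, u n = v n) -> Cser u l -> Cser v l.
Proof.
  intros H [H1 H2]. split; eapply is_series_ext; try eassumption;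
    intros n; simpl; now rewrite H.
Qed.

Lemma Cser_plus u v l l' : Cser u l -> Cser v l' -> Cser (fun n => u n + v n) (l + l').
Proof.
  intros [H1 H2] [H1' H2']. split; [exact (is_series_plus _ _ _ _ H1 H1')|
    exact (is_series_plus _ _ _ _ H2 H2')].
Qed.

Lemma Cser_scal c u l : Cser u l -> Cser (fun n => c * u n) (c * l).
Proof.
  intros [H1 H2]. split; simpl.
  - apply (is_series_minus (fun n => fst c * fst (u n))%R (fun n => snd c * snd (u n))%R);
      now apply (is_series_scal_l (V := R_NormedModule)).
  - apply (is_series_plus (fun n => fst c * snd (u n))%R (fun n => snd c * fst (u n))%R);
      now apply (is_series_scal_l (V := R_NormedModule)).
Qed.

Lemma Cser_finite (u : nat -> C) N : (forall n, (N < n)%nat -> u n = 0) -> Cser u (sum_n u N).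
Proof.
  intros H.
  split; [rewrite fst_csum|rewrite snd_csum]; apply filterlim_locally; intros eps;
    exists N; intros n Hn.
  - rewrite <- !fst_csum, (csum_extend u N n Hn (fun k Hk => H k (proj1 Hk))).
    apply ball_center.
  - rewrite <- !snd_csum, (csum_extend u N n Hn (fun k Hk => H k (proj1 Hk))).
    apply ball_center.
Qed.

Lemma Cmod_csum_le (u : nat -> C) n :
  (Cmod (sum_n u n) <= sum_n (fun k => Cmod (u k)) n)%R.
Proof.
  induction n as [|n IH].
  - rewrite csum_O, sum_O. apply Rle_refl.
  - rewrite csum_S, sum_Sn. eapply Rle_trans; [apply Cmod_triangle|].
    apply Rplus_le_compat_r, IH.
Qed.

Lemma sum_n_le_R (u v : nat -> R) n :
  (forall k, (u k <= v k)%R) -> (sum_n u n <= sum_n v n)%R.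
Proof.
  intros H. induction n as [|n IH]; [rewrite !sum_O; apply H|].
  rewrite !sum_Sn. apply Rplus_le_compat; auto.
Qed.

Lemma Cser_bound u l (M : nat -> R) (S : R) :
  Cser u l -> (forall n, Cmod (u n) <= M n)%R -> is_series M S -> (Cmod l <= S)%R.
Proof.
  intros [H1 H2] HM HS.
  assert (L : is_lim_seq (fun n => Cmod (sum_n u n)) (Cmod l)).
  { apply is_lim_seq_ext with (fun n =>
      sqrt (sum_n (fun k => fst (u k)) n ^ 2 + sum_n (fun k => snd (u k)) n ^ 2)).
    - intros n. now rewrite <- fst_csum, <- snd_csum.
    - apply is_lim_seq_continuous; [apply continuity_pt_sqrt; nra|].
      simpl. apply is_lim_seq_plus'; apply is_lim_seq_mult'; try assumption;
        apply is_lim_seq_mult'; try assumption; apply is_lim_seq_const. }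
  apply (is_lim_seq_le _ _ (Cmod l) S (fun n => Rle_trans _ _ _ (Cmod_csum_le u n)
    (sum_n_le_R _ _ n HM)) L HS).
Qed.

Lemma Rabs_fst_le z : (Rabs (fst z) <= Cmod z)%R.
Proof. eapply Rle_trans; [apply Rmax_l|apply Rmax_Cmod]. Qed.

Lemma Rabs_snd_le z : (Rabs (snd z) <= Cmod z)%R.
Proof. eapply Rle_trans; [apply Rmax_r|apply Rmax_Cmod]. Qed.

Lemma Cmod_le_Rabs z : (Cmod z <= Rabs (fst z) + Rabs (snd z))%R.
Proof.
  replace z with ((fst z, 0%R) + (0%R, snd z)) at 1.
  - eapply Rle_trans; [apply Cmod_triangle|]. apply Req_le. f_equal;
      unfold Cmod; simpl; rewrite <- sqrt_Rsqr_abs; f_equal; unfold Rsqr; ring.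
  - destruct z. unfold Cplus. simpl. f_equal; ring.
Qed.

Lemma Rseries_tail (M : nat -> R) (S : R) n :
  is_series M S -> is_series (fun k => M (Datatypes.S n + k)%nat) (S - sum_n M n)%R.
Proof.
  intros H. apply (is_series_incr_n M (Datatypes.S n)); [lia|].
  refine (eq_ind S (is_series M) H _ _).
  change (S = (S - sum_n M n + sum_n M n)%R :> R). ring.
Qed.

Lemma Cser_tail u l n : Cser u l -> Cser (fun k => u (S n + k)%nat) (l - sum_n u n).
Proof.
  intros [H1 H2]. split.
  - change (is_series (fun k => fst (u (S n + k)%nat)) (fst l - fst (sum_n u n : C))%R).
    rewrite fst_csum. now apply Rseries_tail.
  - change (is_series (fun k => snd (u (S n + k)%nat)) (snd l - snd (sum_n u n : C))%R).
    rewrite snd_csum. now apply Rseries_tail.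
Qed.

Lemma Cser_tail_bound u l (M : nat -> R) (S : R) n :
  Cser u l -> (forall n, Cmod (u n) <= M n)%R -> is_series M S ->
  (Cmod (l - sum_n u n) <= S - sum_n M n)%R.
Proof.
  intros H HM HS. apply (Cser_bound _ _ (fun k => M (Datatypes.S n + k)%nat) _ (Cser_tail u l n H)).
  - intros k. apply HM.
  - now apply Rseries_tail.
Qed.

Lemma is_series_Cser_of_dist u l : (forall eps : posreal, exists N, forall n, (N <= n)%nat ->
  (Cmod (sum_n u n - l) < eps)%R) -> Cser u l.
Proof.
  intros H. split; apply filterlim_locally; intros eps; destruct (H eps) as [N HN];
    exists N; intros n Hn; specialize (HN n Hn);
    (eapply Rle_lt_trans; [|exact HN]).
  - rewrite <- fst_csum. apply (Rabs_fst_le (sum_n u n - l)).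
  - rewrite <- snd_csum. apply (Rabs_snd_le (sum_n u n - l)).
Qed.

Lemma sum_n_minus_R (u v : nat -> R) n :
  (sum_n (fun k => u k - v k) n = sum_n u n - sum_n v n)%R.
Proof.
  induction n as [|n IH]; [now rewrite !sum_O|].
  rewrite !sum_Sn, IH. unfold plus. simpl. ring.
Qed.

(** The Cauchy product theorem for the four pairs of real and imaginary parts. *)
Lemma Cser_mult u v lu lv :
  Cser u lu -> Cser v lv ->
  ex_series (fun n => Cmod (u n)) -> ex_series (fun n => Cmod (v n)) ->
  Cser (conv u v) (lu * lv).
Proof.
  intros [U1 U2] [V1 V2] AU AV.
  assert (A1 : forall w, ex_series (fun n => Cmod (w n)) -> ex_series (fun n => Rabs (fst (w n)))).
  { intros w. apply (ex_series_le (fun n => Rabs (fst (w n)))).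
    intros n. unfold norm. simpl. unfold abs. simpl. rewrite Rabs_Rabsolu. apply Rabs_fst_le. }
  assert (A2 : forall w, ex_series (fun n => Cmod (w n)) -> ex_series (fun n => Rabs (snd (w n)))).
  { intros w. apply (ex_series_le (fun n => Rabs (snd (w n)))).
    intros n. unfold norm. simpl. unfold abs. simpl. rewrite Rabs_Rabsolu. apply Rabs_snd_le. }
  assert (S11 := is_series_mult _ _ _ _ U1 V1 (A1 _ AU) (A1 _ AV)).
  assert (S12 := is_series_mult _ _ _ _ U1 V2 (A1 _ AU) (A2 _ AV)).
  assert (S21 := is_series_mult _ _ _ _ U2 V1 (A2 _ AU) (A1 _ AV)).
  assert (S22 := is_series_mult _ _ _ _ U2 V2 (A2 _ AU) (A2 _ AV)).
  split.
  - refine (is_series_ext _ _ _ _ (is_series_minus _ _ _ _ S11 S22)).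
    intros n. cbv beta. rewrite <- !sum_n_Reals. unfold conv. rewrite fst_csum.
    symmetry. exact (sum_n_minus_R (fun k => fst (u k) * fst (v (n - k)%nat))%R
      (fun k => snd (u k) * snd (v (n - k)%nat))%R n).
  - refine (is_series_ext _ _ _ _ (is_series_plus _ _ _ _ S12 S21)).
    intros n. cbv beta. rewrite <- !sum_n_Reals. unfold conv. rewrite snd_csum.
    symmetry. exact (sum_n_plus (fun k => fst (u k) * snd (v (n - k)%nat))%R
      (fun k => snd (u k) * fst (v (n - k)%nat))%R n).
Qed.

Lemma Cser_terms_bounded u l : Cser u l -> exists N, forall n, (N <= n)%nat ->
  (Cmod (u n) <= 2)%R.
Proof.
  intros [H1 H2].
  assert (L1 := ex_series_lim_0 _ (ex_intro _ _ H1)).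
  assert (L2 := ex_series_lim_0 _ (ex_intro _ _ H2)).
  apply is_lim_seq_spec in L1. apply is_lim_seq_spec in L2.
  (* The terms tend to 0; each coordinate is eventually below 1, whence the bound 2. *)
  destruct (L1 (mkposreal 1 Rlt_0_1)) as [N1 HN1].
  destruct (L2 (mkposreal 1 Rlt_0_1)) as [N2 HN2].
  exists (max N1 N2). intros n Hn.
  specialize (HN1 n ltac:(lia)). specialize (HN2 n ltac:(lia)).
  simpl in HN1, HN2. rewrite Rminus_0_r in *.
  pose proof (Cmod_le_Rabs (u n)). lra.
Qed.

(** Abel's lemma: comparison with a geometric series of ratio |w|/|z|. *)
Lemma C_pseries_abs c z l w : C_pseries c z l -> (Cmod w < Cmod z)%R ->
  ex_series (fun n => Cmod (c n * w ^ n)).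
Proof.
  intros H Hw. apply C_pseries_iff in H.
  destruct (Cser_terms_bounded _ _ H) as [N HN].
  assert (Hw0 := Cmod_ge_0 w).
  apply (ex_series_incr_n _ N).
  apply (ex_series_le (fun n => Cmod (c (N + n)%nat * w ^ (N + n)))
    (fun n => 2 * (Cmod w / Cmod z) ^ (N + n))%R).
  - intros n. unfold norm. simpl. unfold abs. simpl.
    rewrite Rabs_pos_eq by apply Cmod_ge_0.
    specialize (HN (N + n)%nat ltac:(lia)).
    rewrite !Cmod_mult, !Cmod_pow in *.
    unfold Rdiv. rewrite Rpow_mult_distr, pow_inv.
    assert (Hz : (0 < Cmod z ^ (N + n))%R) by (apply pow_lt; lra).
    assert (Hwn : (0 <= Cmod w ^ (N + n))%R) by (apply pow_le; lra).
    apply (Rmult_le_reg_r (Cmod z ^ (N + n))); [exact Hz|].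
    replace (2 * (Cmod w ^ (N + n) * / Cmod z ^ (N + n)) * Cmod z ^ (N + n))%R
      with (2 * Cmod w ^ (N + n))%R by (field; lra).
    nra.
  - apply (ex_series_scal_l (K := R_AbsRing) (V := R_NormedModule) 2%R).
    apply (ex_series_incr_n (fun n => (Cmod w / Cmod z) ^ n)%R N), ex_series_geom.
    rewrite Rabs_pos_eq; [|apply Rdiv_le_0_compat; lra].
    apply (Rmult_lt_reg_r (Cmod z)); [lra|]. field_simplify; lra.
Qed.

Lemma C_pseries_abs_disc c r w :
  (forall z, (Cmod z < r)%R -> exists l, C_pseries c z l) -> (Cmod w < r)%R ->
  ex_series (fun n => Cmod (c n * w ^ n)).
Proof.
  intros H Hw. pose proof (Cmod_ge_0 w).
  assert (E : Cmod (RtoC ((Cmod w + r) / 2)) = ((Cmod w + r) / 2)%R).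
  { rewrite Cmod_R, Rabs_pos_eq; lra. }
  destruct (H (RtoC ((Cmod w + r) / 2))) as [l Hl]; [lra|].
  apply (C_pseries_abs _ _ _ _ Hl). lra.
Qed.

Lemma C_pseries_mult c d r z l l' :
  (forall z, (Cmod z < r)%R -> exists l, C_pseries c z l) ->
  (forall z, (Cmod z < r)%R -> exists l, C_pseries d z l) ->
  (Cmod z < r)%R -> C_pseries c z l -> C_pseries d z l' ->
  C_pseries (conv c d) z (l * l').
Proof.
  intros Hc Hd Hz Hl Hl'. rewrite C_pseries_iff in *.
  refine (Cser_ext _ _ _ _ (Cser_mult _ _ _ _ Hl Hl'
    (C_pseries_abs_disc _ _ _ Hc Hz) (C_pseries_abs_disc _ _ _ Hd Hz))).
  intros n. unfold conv. rewrite Cmult_comm, <- csum_mult_l. apply csum_ext.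
  intros k Hk. replace n with (k + (n - k))%nat at 3 by lia.
  rewrite Cpow_add_r. ring.
Qed.

Lemma C_pseries_unique c z l l' : C_pseries c z l -> C_pseries c z l' -> l = l'.
Proof. rewrite !C_pseries_iff. apply Cser_unique. Qed.

Lemma C_pseries_ext c d z l : (forall n, c n = d n) -> C_pseries c z l -> C_pseries d z l.
Proof.
  intros H. rewrite !C_pseries_iff. apply Cser_ext. intros n. now rewrite H.
Qed.

Lemma C_pseries_plus c d z l l' : C_pseries c z l -> C_pseries d z l' ->
  C_pseries (fun n => c n + d n) z (l + l').
Proof.
  rewrite !C_pseries_iff. intros H H'.
  refine (Cser_ext _ _ _ _ (Cser_plus _ _ _ _ H H')). intros n. ring.
Qed.

Lemma C_pseries_scal s c z l : C_pseries c z l -> C_pseries (fun n => s * c n) z (s * l).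
Proof.
  rewrite !C_pseries_iff. intros H.
  refine (Cser_ext _ _ _ _ (Cser_scal s _ _ H)). intros n. ring.
Qed.

Lemma C_pseries_finite (c : nat -> C) z l N : (forall n, (N < n)%nat -> c n = 0) ->
  sum_n (fun n => c n * z ^ n) N = l :> C -> C_pseries c z l.
Proof.
  intros H <-. apply C_pseries_iff, Cser_finite. intros n Hn. rewrite H by exact Hn. ring.
Qed.

Lemma C_pseries_delay c z l : C_pseries c z l -> C_pseries (delay c) z (z * l).
Proof.
  rewrite !C_pseries_iff. intros H. apply (Cser_scal z) in H. destruct H as [H1 H2].
  split.
  - apply (is_series_decr_1 (V := R_NormedModule)).
    replace (opp _) with (zero : R_NormedModule)
      by (unfold opp, zero; simpl; ring). rewrite plus_zero_r.
    refine (is_series_ext _ _ _ _ H1). intros n. f_equal. simpl. ring.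
  - apply (is_series_decr_1 (V := R_NormedModule)).
    replace (opp _) with (zero : R_NormedModule)
      by (unfold opp, zero; simpl; ring). rewrite plus_zero_r.
    refine (is_series_ext _ _ _ _ H2). intros n. f_equal. simpl. ring.
Qed.

(** * Analytic functions and uniqueness of continuations *)

Lemma analytic_at_ext F G z0 : (forall z, F z = G z) -> analytic_at F z0 -> analytic_at G z0.
Proof.
  intros H (c & d & Hd & HF). exists c, d. split; [exact Hd|].
  intros z Hz. rewrite <- H. now apply HF.
Qed.

Lemma analytic_at_disc F z0 (c : nat -> C) d :
  (forall z, (Cmod (z - z0) < d)%R -> C_pseries c (z - z0) (F z)) ->
  forall w, (Cmod w < d)%R -> C_pseries c w (F (z0 + w)).
Proof.
  intros H w Hw. assert (E : w = z0 + w - z0) by ring.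
  rewrite E at 1. apply H. now rewrite <- E.
Qed.

Lemma analytic_at_mult F G z0 : analytic_at F z0 -> analytic_at G z0 ->
  analytic_at (fun z => F z * G z) z0.
Proof.
  intros (c & d & Hd & HF) (c' & d' & Hd' & HG).
  exists (conv c c'), (Rmin d d'). split; [now apply Rmin_pos|]. intros z Hz.
  assert (L1 := Rmin_l d d'). assert (L2 := Rmin_r d d').
  apply (C_pseries_mult _ _ (Rmin d d')); [| |exact Hz|apply HF; lra|apply HG; lra].
  - intros w Hw. eexists. apply (analytic_at_disc _ _ _ _ HF). lra.
  - intros w Hw. eexists. apply (analytic_at_disc _ _ _ _ HG). lra.
Qed.

Lemma analytic_at_plus F G z0 : analytic_at F z0 -> analytic_at G z0 ->
  analytic_at (fun z => F z + G z) z0.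
Proof.
  intros (c & d & Hd & HF) (c' & d' & Hd' & HG).
  exists (fun n => c n + c' n), (Rmin d d'). split; [now apply Rmin_pos|]. intros z Hz.
  assert (L1 := Rmin_l d d'). assert (L2 := Rmin_r d d').
  apply C_pseries_plus; [apply HF|apply HG]; lra.
Qed.

Lemma analytic_at_const s z0 : analytic_at (fun _ => s) z0.
Proof.
  exists (fun n => match n with O => s | S _ => 0 end), 1%R.
  split; [apply Rlt_0_1|]. intros z _.
  apply (C_pseries_finite _ _ _ 0).
  - intros [|n] Hn; [lia|reflexivity].
  - rewrite csum_O. simpl. ring.
Qed.

Lemma analytic_at_id z0 : analytic_at (fun z => z) z0.
Proof.
  exists (fun n => match n with O => z0 | S O => 1 | S (S _) => 0 end), 1%R.
  split; [apply Rlt_0_1|]. intros z _.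
  apply (C_pseries_finite _ _ _ 1).
  - intros [|[|n]] Hn; [lia|lia|reflexivity].
  - rewrite csum_S, csum_O. simpl. ring.
Qed.

Lemma analytic_at_pow n z0 : analytic_at (fun z => z ^ n) z0.
Proof.
  induction n as [|n IH]; [exact (analytic_at_const 1 z0)|].
  apply (analytic_at_mult (fun z => z) (fun z => z ^ n)); [apply analytic_at_id|exact IH].
Qed.

Lemma analytic_at_sum (F : nat -> C -> C) n z0 : (forall k, analytic_at (F k) z0) ->
  analytic_at (fun z => sum_n (fun k => F k z) n) z0.
Proof.
  intros H. induction n as [|n IH].
  - apply (analytic_at_ext (F 0%nat)); [|apply H]. intros z. now rewrite csum_O.
  - apply (analytic_at_ext (fun z => sum_n (fun k => F k z) n + F (S n) z)).
    + intros z. now rewrite csum_S.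
    + apply analytic_at_plus; [exact IH|apply H].
Qed.

(** If c_m is the first coefficient not known to vanish, then F z = c_m z^m + O(z^(m+1)), and zeros
    tending to 0 force c_m = 0. *)
Lemma C_pseries_isolated_zero (c : nat -> C) d (F : C -> C) : (0 < d)%R ->
  (forall z, (Cmod z < d)%R -> C_pseries c z (F z)) ->
  (forall eps, (0 < eps)%R -> exists z, (0 < Cmod z < eps)%R /\ F z = 0) ->
  forall n, c n = 0.
Proof.
  intros Hd HF Hz n. induction n as [m IH] using lt_wf_ind.
  set (r := (d / 2)%R).
  assert (Er : Cmod (RtoC r) = r) by (rewrite Cmod_R, Rabs_pos_eq; unfold r; lra).
  assert (HS : ex_series (fun n => Cmod (c n * RtoC r ^ n))).
  { apply (C_pseries_abs_disc _ d); [|rewrite Er; unfold r; lra].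
    intros z Hz'. eexists. now apply HF. }
  apply (ex_series_incr_n _ (S m)) in HS. destruct HS as [T HT].
  assert (Hr : (0 < r)%R) by (unfold r; lra).
  assert (HT0 : (0 <= T)%R).
  { refine (is_lim_seq_le (fun _ => 0%R) _ 0 T _ (is_lim_seq_const 0) HT).
    intros k. induction k as [|k IHk]; [rewrite sum_O; apply Cmod_ge_0|].
    rewrite sum_Sn. apply Rplus_le_le_0_compat; [exact IHk|apply Cmod_ge_0]. }
  assert (Hpr : (0 < r ^ S m)%R) by now apply pow_lt.
  (* At a zero, c_m z^m is minus the tail of the series, which is at most (|z|/r)^(m+1) T. *)
  assert (K : forall z, (0 < Cmod z < r)%R -> F z = 0 ->
    (Cmod (c m) <= Cmod z * (T / r ^ S m))%R).
  { intros z Hz1 Hz2.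
    assert (H := HF z ltac:(unfold r in *; lra)). rewrite Hz2 in H.
    apply C_pseries_iff in H.
    assert (H' := Cser_tail _ _ m H).
    replace (0 - sum_n (fun n => c n * z ^ n) m) with (- (c m * z ^ m)) in H'.
    2: { destruct m as [|m]; [rewrite csum_O; ring|].
         rewrite csum_S, csum_zero; [ring|].
         intros k Hk. rewrite IH by lia. ring. }
    assert (B := Cser_bound _ _ (fun k => Cmod z ^ S m * / r ^ S m *
      Cmod (c (S m + k)%nat * RtoC r ^ (S m + k)))%R
      (Cmod z ^ S m * / r ^ S m * T)%R H').
    rewrite Cmod_opp, Cmod_mult, Cmod_pow in B.
    assert (Hzm : (0 < Cmod z ^ m)%R) by (apply pow_lt; lra).
    apply (Rmult_le_reg_r (Cmod z ^ m)); [exact Hzm|].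
    replace (Cmod z * (T / r ^ S m) * Cmod z ^ m)%R with (Cmod z ^ S m * / r ^ S m * T)%R
      by (simpl; field; split; apply Rgt_not_eq; [apply pow_lt|]; assumption).
    apply B.
    - intros k. rewrite !Cmod_mult, !Cmod_pow, Er, !pow_add.
      replace (Cmod z ^ S m * / r ^ S m * (Cmod (c (S m + k)%nat) * (r ^ S m * r ^ k)))%R
        with (Cmod (c (S m + k)%nat) * (Cmod z ^ S m * r ^ k))%R by (field; lra).
      apply Rmult_le_compat_l; [apply Cmod_ge_0|].
      apply Rmult_le_compat_l; [apply pow_le; lra|].
      apply pow_incr. lra.
    - exact (is_series_scal_l (V := R_NormedModule) _ _ _ HT). }
  apply Cmod_eq_0. apply Rle_antisym; [|apply Cmod_ge_0].
  apply Rnot_lt_le. intros Hc.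
  set (Q := (T / r ^ S m)%R) in *.
  assert (HQ : (0 <= Q)%R) by (apply Rdiv_le_0_compat; assumption).
  (* The choice |z| < |c_m|/(Q+1) contradicts |c_m| <= |z| Q; the 1 allows Q = 0. *)
  destruct (Hz (Rmin r (Cmod (c m) / (Q + 1)))%R) as (z & Hz1 & Hz2).
  { apply Rmin_pos; [exact Hr|apply Rdiv_lt_0_compat; lra]. }
  pose proof (Rmin_l r (Cmod (c m) / (Q + 1))).
  pose proof (Rmin_r r (Cmod (c m) / (Q + 1))).
  assert (H1 := K z ltac:(lra) Hz2).
  assert (H2 : (Cmod z * (Q + 1) < Cmod (c m))%R).
  { apply (Rmult_lt_reg_r (/ (Q + 1))); [apply Rinv_0_lt_compat; lra|].
    rewrite Rmult_assoc, Rinv_r by lra. unfold Rdiv in *. lra. }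
  nra.
Qed.

Lemma slit_plane_star x t : slit_plane x -> (0 <= t <= 1)%R -> slit_plane (t * x).
Proof.
  unfold slit_plane. destruct x as [p q]. simpl. intros H Ht [H1 H2]. apply H.
  assert (t <> 0)%R by (intros ->; lra).
  split; [apply (Rmult_eq_reg_l t); lra|nra].
Qed.

Lemma analytic_zero_slit (D : C -> C) x :
  (forall z, (Cmod z < 1)%R -> D z = 0) ->
  (forall z, slit_plane z -> analytic_at D z) ->
  slit_plane x -> D x = 0.
Proof.
  intros H0 HD Hx.
  assert (Hm := Cmod_ge_0 x).
  destruct (Rle_lt_dec 1 (Cmod x)) as [Hx1|Hx1]; [|now apply H0].
  set (E := fun t : R => (0 <= t <= 1)%R /\ forall s : R, (0 <= s <= t)%R -> D (s * x) = 0).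
  assert (Hcm : forall s : R, Cmod (s * x) = (Rabs s * Cmod x)%R)
    by (intros; now rewrite Cmod_mult, Cmod_R).
  (* The point e0 x lies in the unit disc, so the supremum t0 below is positive and there are zeros
     before t0 x. *)
  set (e0 := (/ 2 / Cmod x)%R).
  assert (He0 : (0 < e0)%R) by (apply Rdiv_lt_0_compat; lra).
  assert (He0x : (e0 * Cmod x = / 2)%R) by (unfold e0; field; lra).
  assert (HE0 : E e0).
  { split; [nra|]. intros s Hs. apply H0. rewrite Hcm, Rabs_pos_eq by lra. nra. }
  destruct (completeness E) as [t0 [Hub Hlub]].
  { exists 1%R. intros t Ht. apply Ht. }
  { now exists e0. }
  assert (Ht0 : (e0 <= t0)%R) by now apply Hub.
  assert (Ht1 : (t0 <= 1)%R) by (apply Hlub; intros t Ht; apply Ht).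
  assert (Hlt : forall s : R, (0 <= s < t0)%R -> D (s * x) = 0).
  { intros s Hs. apply NNPP. intros Hn.
    assert (t0 <= s)%R; [|lra]. apply Hlub. intros t [Ht HDt].
    apply Rnot_lt_le. intros Hst. apply Hn, HDt. lra. }
  destruct (HD (t0 * x)) as (c & d & Hd & HF).
  { apply slit_plane_star; [exact Hx|lra]. }
  assert (Hc : forall n, c n = 0).
  { apply (C_pseries_isolated_zero c d (fun w => D (t0 * x + w)) Hd).
    - intros z Hz. now apply (analytic_at_disc _ _ _ _ HF).
    - intros eps Heps.
      set (h := Rmin (t0 / 2) (eps / 2 / Cmod x)).
      assert (Hh : (0 < h)%R).
      { apply Rmin_pos; [lra|]. repeat apply Rdiv_lt_0_compat; lra. }
      assert (Hh1 := Rmin_l (t0 / 2) (eps / 2 / Cmod x)). fold h in Hh1.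
      assert (Hh2 := Rmin_r (t0 / 2) (eps / 2 / Cmod x)). fold h in Hh2.
      assert (Hh3 : (h * Cmod x <= eps / 2)%R).
      { apply (Rmult_le_compat_r (Cmod x)) in Hh2; [|lra].
        replace (eps / 2 / Cmod x * Cmod x)%R with (eps / 2)%R in Hh2 by (field; lra).
        exact Hh2. }
      exists (RtoC (- h) * x). rewrite Hcm, Rabs_Ropp, Rabs_pos_eq by lra. split.
      + split; [apply Rmult_lt_0_compat; lra|lra].
      + transitivity (D (RtoC (t0 - h) * x)); [|apply Hlt; lra].
        apply f_equal. rewrite RtoC_minus, RtoC_opp. ring. }
  assert (HD0 : forall z, (Cmod (z - t0 * x) < d)%R -> D z = 0).
  { intros z Hz. apply (C_pseries_unique c (z - t0 * x)); [now apply HF|].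
    apply (C_pseries_finite _ _ _ 0); [intros n _; apply Hc|].
    rewrite csum_O, Hc. ring. }
  (* D vanishes near t0 x, so the zeros extend by h past t0. Either they reach x, or t0 was no upper
     bound. *)
  set (h := (d / 2 / Cmod x)%R).
  assert (Hh : (0 < h)%R) by (repeat apply Rdiv_lt_0_compat; lra).
  assert (Hhx : (h * Cmod x = d / 2)%R) by (unfold h; field; lra).
  assert (Hnear : forall s : R, (t0 <= s <= t0 + h)%R -> D (s * x) = 0).
  { intros s Hs. apply HD0. replace (s * x - t0 * x) with (RtoC (s - t0) * x)
      by (rewrite RtoC_minus; ring).
    rewrite Hcm, Rabs_pos_eq by lra. nra. }
  destruct (Rle_lt_dec 1 (t0 + h)) as [H1|H1].
  - rewrite <- (Cmult_1_l x). apply Hnear. lra.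
  - assert (t0 + h <= t0)%R; [|lra]. apply Hub. split; [lra|].
    intros s Hs. destruct (Rle_lt_dec t0 s); [apply Hnear|apply Hlt]; lra.
Qed.

Lemma hyp_continuation_unique top bot F G x :
  is_hyp_continuation top bot F -> is_hyp_continuation top bot G ->
  slit_plane x -> F x = G x.
Proof.
  intros [F1 F2] [G1 G2] Hx.
  assert (H : F x + (-1) * G x = 0).
  { apply (analytic_zero_slit (fun z => F z + (-1) * G z)); [| |exact Hx].
    - intros z Hz. rewrite (C_pseries_unique _ _ _ _ (F1 z Hz) (G1 z Hz)). ring.
    - intros z Hz. apply analytic_at_plus; [now apply F2|].
      apply analytic_at_mult; [apply analytic_at_const|now apply G2]. }
  transitivity (F x + (-1) * G x + G x); [ring|rewrite H; ring].
Qed.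

(** The only access to [hyp]: a single exhibited continuation determines its values. *)
Lemma hyp_eq top bot F x : is_hyp_continuation top bot F -> slit_plane x ->
  hyp top bot x = F x.
Proof.
  intros HF. apply (hyp_continuation_unique top bot); [|exact HF].
  apply (epsilon_spec (inhabits (fun _ : C => RtoC 0)) (is_hyp_continuation top bot)).
  now exists F.
Qed.

(** * The binomial series *)

(** Derivatives along a real parameter suffice, because everything is followed along segments. *)
Definition Cder (f : R -> C) (t : R) (l : C) : Prop :=
  is_derive (fun s => fst (f s)) t (fst l) /\ is_derive (fun s => snd (f s)) t (snd l).

Lemma Cder_eq f t l l' : Cder f t l -> l = l' -> Cder f t l'.
Proof. now intros H <-. Qed.

Lemma is_derive_Rmult (f g : R -> R) t a b : is_derive f t a -> is_derive g t b ->
  is_derive (fun s => f s * g s)%R t (a * g t + f t * b)%R.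
Proof. intros Hf Hg. exact (is_derive_mult f g t a b Hf Hg Rmult_comm). Qed.

Lemma is_derive_Rcomp (f g : R -> R) t a b : is_derive f (g t) a -> is_derive g t b ->
  is_derive (fun s => f (g s)) t (b * a)%R.
Proof. intros Hf Hg. exact (is_derive_comp f g t a b Hf Hg). Qed.

Lemma Cder_mult f g t lf lg : Cder f t lf -> Cder g t lg ->
  Cder (fun s => f s * g s) t (lf * g t + f t * lg).
Proof.
  intros [F1 F2] [G1 G2].
  assert (H11 := is_derive_Rmult _ _ _ _ _ F1 G1).
  assert (H12 := is_derive_Rmult _ _ _ _ _ F1 G2).
  assert (H21 := is_derive_Rmult _ _ _ _ _ F2 G1).
  assert (H22 := is_derive_Rmult _ _ _ _ _ F2 G2).
  split; simpl.
  - evar_last; [exact (is_derive_minus _ _ _ _ _ H11 H22)|].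
    unfold minus, plus, opp; simpl. ring.
  - evar_last; [exact (is_derive_plus _ _ _ _ _ H12 H21)|].
    unfold plus; simpl. ring.
Qed.

Lemma Cder_const c t : Cder (fun _ => c) t 0.
Proof. split; apply (is_derive_const (V := R_NormedModule)). Qed.

Lemma Cder_exp f t l : Cder f t l -> Cder (fun s => Cexp (f s)) t (l * Cexp (f t)).
Proof.
  intros [F1 F2].
  assert (E := is_derive_Rcomp exp _ _ _ _ (is_derive_exp _) F1).
  assert (Co := is_derive_Rcomp cos _ _ _ _ (is_derive_cos _) F2).
  assert (Si := is_derive_Rcomp sin _ _ _ _ (is_derive_sin _) F2).
  split.
  - evar_last; [exact (is_derive_Rmult _ _ _ _ _ E Co)|]. unfold Cexp, Re, Im. simpl. ring.
  - evar_last; [exact (is_derive_Rmult _ _ _ _ _ E Si)|]. unfold Cexp, Re, Im. simpl. ring.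
Qed.

Lemma Cder_0_const f : (forall t, (0 <= t <= 1)%R -> Cder f t 0) -> f 1%R = f 0%R.
Proof.
  intros H.
  assert (K : forall g : R -> R, (forall t, (0 <= t <= 1)%R -> is_derive g t 0%R) ->
    g 1%R = g 0%R).
  { intros g Hg. destruct (MVT_gen g 0 1 (fun _ => 0%R)) as (c & _ & E).
    - intros t. rewrite Rmin_left, Rmax_right by lra. intros Ht. apply Hg. lra.
    - intros t. rewrite Rmin_left, Rmax_right by lra. intros Ht.
      apply continuity_pt_filterlim. apply (ex_derive_continuous g). eexists. now apply Hg.
    - lra. }
  apply injective_projections.
  - apply (K (fun s => fst (f s))). intros t Ht. apply (H t Ht).
  - apply (K (fun s => snd (f s))). intros t Ht. apply (H t Ht).
Qed.

Lemma Cexp_plus z w : Cexp (z + w) = Cexp z * Cexp w.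
Proof.
  unfold Cexp, Cmult, Re, Im. simpl. rewrite exp_plus, cos_plus, sin_plus.
  f_equal; ring.
Qed.

Lemma Cexp_0 : Cexp 0 = 1.
Proof. unfold Cexp, Re, Im. simpl. rewrite exp_0, cos_0, sin_0. unfold RtoC. f_equal; ring. Qed.

Lemma Cpower_plus z s t : Cpower z (s + t) = Cpower z s * Cpower z t.
Proof. unfold Cpower. rewrite <- Cexp_plus. f_equal. ring. Qed.

Lemma Cpower_0_r z : Cpower z 0 = 1.
Proof. unfold Cpower. rewrite <- Cexp_0. f_equal. ring. Qed.

Lemma Cpower_opp z s : Cpower z s * Cpower z (- s) = 1.
Proof. rewrite <- Cpower_plus, <- (Cpower_0_r z). f_equal. ring. Qed.

Lemma Cpower_1_l s : Cpower 1 s = 1.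
Proof.
  unfold Cpower. replace (Clog 1) with (RtoC 0).
  - rewrite Cmult_0_r. apply Cexp_0.
  - unfold Clog, Carg. rewrite Cmod_1, ln_1. change (Im 1) with 0%R.
    unfold Rdiv. rewrite Rmult_0_l, atan_0, Rmult_0_r. reflexivity.
Qed.

(** |w| + Re w is the denominator in [Carg]; it vanishes only for w on (-oo, 0]. *)
Lemma slit_plane_pos x : slit_plane x -> (0 < Cmod (1 - x) + Re (1 - x))%R.
Proof.
  intros H. pose proof (re_le_Cmod (1 - x)) as H1. pose proof (Cmod_ge_0 (1 - x)) as H0.
  destruct (Rlt_le_dec 0 (Re (1 - x))) as [Hr|Hr]; [lra|].
  rewrite Rabs_left1 in H1 by exact Hr.
  destruct (Req_dec (Cmod (1 - x)) (- Re (1 - x))) as [E|E]; [|lra].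
  exfalso. apply H. pose proof (Cmod2_alt (1 - x)) as E2. rewrite E in E2.
  assert (E3 : (Re (1 - x) ^ 2 + Im (1 - x) ^ 2 = Re (1 - x) ^ 2)%R).
  { apply RtoC_inj. rewrite <- E2. f_equal. ring. }
  unfold Re, Im in *. simpl in *. split; [nra|lra].
Qed.

Lemma ln_mod_derive p1 p2 q1 q2 t :
  let X := (p1 + t * q1)%R in let Y := (p2 + t * q2)%R in
  (0 < X ^ 2 + Y ^ 2)%R ->
  is_derive (fun s => ln (sqrt ((p1 + s * q1) ^ 2 + (p2 + s * q2) ^ 2))) t
    ((q1 * X + q2 * Y) / (X ^ 2 + Y ^ 2))%R.
Proof.
  intros X Y H.
  assert (Hs := sqrt_lt_R0 _ H). assert (Hss := sqrt_sqrt _ (Rlt_le _ _ H)).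
  auto_derive; fold X Y; rewrite ?Rmult_1_r in *.
  - replace (X * X + Y * Y)%R with (X ^ 2 + Y ^ 2)%R by ring. auto.
  - replace (X * X + Y * Y)%R with (X ^ 2 + Y ^ 2)%R by ring.
    set (s := sqrt (X ^ 2 + Y ^ 2)) in *. rewrite <- Hss. field. lra.
Qed.

Lemma arg_derive p1 p2 q1 q2 t :
  let X := (p1 + t * q1)%R in let Y := (p2 + t * q2)%R in
  (0 < X ^ 2 + Y ^ 2)%R -> (0 < sqrt (X ^ 2 + Y ^ 2) + X)%R ->
  is_derive (fun s => 2 * atan ((p2 + s * q2) /
      (sqrt ((p1 + s * q1) ^ 2 + (p2 + s * q2) ^ 2) + (p1 + s * q1))))%R t
    ((q2 * X - q1 * Y) / (X ^ 2 + Y ^ 2))%R.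
Proof.
  intros X Y H HD.
  assert (Hs := sqrt_lt_R0 _ H). assert (Hss := sqrt_sqrt _ (Rlt_le _ _ H)).
  auto_derive; fold X Y; rewrite ?Rmult_1_r in *;
    replace (X * X + Y * Y)%R with (X ^ 2 + Y ^ 2)%R by ring.
  - repeat split; auto; lra.
  - set (s := sqrt (X ^ 2 + Y ^ 2)) in *. rewrite <- Hss.
    assert (HY : (Y ^ 2 = s * s - X ^ 2)%R) by lra.
    (* With s the modulus, Y^2 = s^2 - X^2; this reduces the derivative of the half-angle formula to
       the denominator s^2. *)
    assert (HE : ((s + X) ^ 2 + Y ^ 2 = 2 * s * (s + X))%R) by nra.
    transitivity (2 * ((q2 * (s + X) - Y * ((q1 * X + q2 * Y) / s + q1)) /
      ((s + X) ^ 2 + Y ^ 2)))%R.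
    { field. repeat split; try lra. rewrite HE. apply Rgt_not_eq. nra. }
    rewrite HE.
    apply (Rmult_eq_reg_r (s * s * (s + X))%R); [|apply Rgt_not_eq; repeat apply Rmult_lt_0_compat; lra].
    transitivity ((q2 * (s + X) * s - q1 * Y * X - q2 * Y ^ 2 - q1 * Y * s))%R; [field; lra|].
    rewrite HY. field. lra.
Qed.

Lemma Cder_Clog p q (t : R) : (0 < Cmod (p + t * q) + Re (p + t * q))%R ->
  Cder (fun s => Clog (p + s * q)) t (q / (p + t * q)).
Proof.
  destruct p as [p1 p2], q as [q1 q2]. intros H.
  set (X := (p1 + t * q1)%R). set (Y := (p2 + t * q2)%R).
  assert (E : forall s : R, (p1, p2) + s * (q1, q2) = ((p1 + s * q1)%R, (p2 + s * q2)%R)).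
  { intros s. unfold Cplus, Cmult. simpl. f_equal; ring. }
  rewrite E in *. fold X Y in H |- *. unfold Cmod, Re in H. simpl fst in H. simpl snd in H.
  assert (HXY : (0 < X ^ 2 + Y ^ 2)%R).
  { apply Rnot_le_lt. intros HXY. assert (HX : X = 0%R) by nra.
    rewrite sqrt_neg_0, HX in H by exact HXY. lra. }
  split.
  - apply (is_derive_ext (fun s => ln (sqrt ((p1 + s * q1) ^ 2 + (p2 + s * q2) ^ 2)))).
    + intros s. now rewrite E.
    + evar_last; [now apply ln_mod_derive|]. fold X Y. simpl. field. nra.
  - apply (is_derive_ext (fun s => 2 * atan ((p2 + s * q2) /
      (sqrt ((p1 + s * q1) ^ 2 + (p2 + s * q2) ^ 2) + (p1 + s * q1))))%R).
    + intros s. now rewrite E.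
    + evar_last; [now apply arg_derive|]. fold X Y. simpl. field. nra.
Qed.

Lemma Cder_Cpower p q (t : R) s : (0 < Cmod (p + t * q) + Re (p + t * q))%R ->
  Cder (fun u => Cpower (p + u * q) s) t (s * (q / (p + t * q)) * Cpower (p + t * q) s).
Proof.
  intros H. unfold Cpower.
  apply (Cder_eq _ _ ((0 * Clog (p + t * q) + s * (q / (p + t * q))) *
    Cexp (s * Clog (p + t * q)))); [|ring].
  apply (Cder_exp (fun u => s * Clog (p + u * q))).
  apply (Cder_mult (fun _ => s)); [apply Cder_const|now apply Cder_Clog].
Qed.

Lemma binc_abs s (rho : R) : (0 <= rho < 1)%R ->
  ex_series (fun n => (Cmod (binc s n) * rho ^ n)%R).
Proof.
  intros Hr.
  (* [binc s] may vanish from some index on, so the ratio test is applied to a positive majorant M;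
     the 1 keeps M positive for s = 0. *)
  set (K := (Cmod s + 1)%R). assert (Hs := Cmod_ge_0 s).
  set (M := fix M n := match n with O => 1%R | S k => (M k * ((K + k) / (k + 1)))%R end).
  assert (HM : forall n, (0 < M n)%R).
  { induction n as [|n IH]; [apply Rlt_0_1|]. simpl.
    pose proof (pos_INR n). apply Rmult_lt_0_compat; [exact IH|].
    apply Rdiv_lt_0_compat; unfold K; lra. }
  assert (HB : forall n, (Cmod (binc s n) <= M n)%R).
  { induction n as [|n IH]; [rewrite binc_0, Cmod_1; apply Rle_refl|].
    replace (binc s (S n)) with (binc s n * ((s + n) / (n + 1))).
    - rewrite Cmod_mult. simpl. pose proof (pos_INR n).
      apply Rmult_le_compat; try apply Cmod_ge_0; [exact IH|].
      rewrite Cmod_div by apply INR_S_neq_0.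
      rewrite <- RtoC_plus, Cmod_R, (Rabs_pos_eq (n + 1)) by lra.
      apply Rmult_le_compat_r; [left; apply Rinv_0_lt_compat; lra|].
      eapply Rle_trans; [apply Cmod_triangle|]. rewrite Cmod_R, Rabs_pos_eq by lra.
      unfold K. lra.
    - apply (Cmult_eq_reg_l (n + 1)); [apply INR_S_neq_0|].
      rewrite binc_S. field. apply INR_S_neq_0. }
  (* The ratio test needs nonzero terms, which excludes rho = 0. *)
  destruct (Req_dec rho 0) as [->|Hr0].
  - exists (Cmod (binc s 0)). apply (is_series_decr_1 (V := R_NormedModule)).
    apply (is_series_ext (fun _ => 0%R)); [intros n; simpl; ring|].
    simpl pow. unfold plus, opp. simpl.
    replace (_ + - _)%R with 0%R by ring.
    apply filterlim_locally. intros eps. exists 0%nat. intros n _.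
    rewrite sum_n_const, Rmult_0_r. apply ball_center.
  - apply (ex_series_le (fun n => Cmod (binc s n) * rho ^ n)%R (fun n => Rabs (M n * rho ^ n))).
    + intros n. unfold norm. simpl. unfold abs. simpl.
      rewrite !Rabs_mult. apply Rmult_le_compat_r; [apply Rabs_pos|].
      rewrite !Rabs_pos_eq; [apply HB|left; apply HM|apply Cmod_ge_0].
    + apply (ex_series_DAlembert _ rho); [lra| |].
      * intros n. apply Rmult_integral_contrapositive. split.
        -- apply Rgt_not_eq, HM.
        -- apply pow_nonzero, Hr0.
      * apply is_lim_seq_ext with (fun n => ((1 + (K - 1) * / INR (S n)) * rho)%R).
        -- intros n. pose proof (pos_INR n). specialize (HM n).
           assert (0 < rho ^ n)%R by (apply pow_lt; lra).
           rewrite Rabs_pos_eq.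
           ++ rewrite S_INR. simpl. field. repeat split; lra.
           ++ simpl. apply Rdiv_le_0_compat; [|nra].
              repeat apply Rmult_le_pos; try lra; [|left; apply Rinv_0_lt_compat; lra].
              unfold K; lra.
        -- replace (Finite rho) with (Finite ((1 + (K - 1) * 0) * rho)%R) by (f_equal; ring).
           apply is_lim_seq_mult'; [|apply is_lim_seq_const].
           apply is_lim_seq_plus'; [apply is_lim_seq_const|].
           apply is_lim_seq_mult'; [apply is_lim_seq_const|].
           apply (is_lim_seq_incr_1 (fun n => (/ INR n)%R)).
           replace (Finite 0) with (Rbar_inv p_infty) by reflexivity.
           apply is_lim_seq_inv; [apply is_lim_seq_INR|discriminate].
Qed.

Lemma real_pseries c (t : R) :
  Rbar_lt (Rabs t) (CV_radius (fun n => fst (c n))) ->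
  Rbar_lt (Rabs t) (CV_radius (fun n => snd (c n))) ->
  C_pseries c t (PSeries (fun n => fst (c n)) t, PSeries (fun n => snd (c n)) t).
Proof.
  intros H1 H2. apply C_pseries_iff.
  assert (E : forall n, c n * t ^ n = ((fst (c n) * t ^ n)%R, (snd (c n) * t ^ n)%R)).
  { intros n. rewrite <- RtoC_pow. unfold Cmult, RtoC. simpl. f_equal; ring. }
  split.
  - apply (is_series_ext (fun n => fst (c n) * t ^ n)%R).
    + intros n. rewrite E. reflexivity.
    + apply Series_correct, ex_pseries_R. now apply CV_radius_inside.
  - apply (is_series_ext (fun n => snd (c n) * t ^ n)%R).
    + intros n. rewrite E. reflexivity.
    + apply Series_correct, ex_pseries_R. now apply CV_radius_inside.
Qed.

Lemma CV_radius_gt_1 (u : nat -> R) (r : R) : (1 < r)%R ->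
  ex_series (fun n => Rabs (u n) * r ^ n)%R -> Rbar_lt 1 (CV_radius u).
Proof.
  intros Hr H. apply Rbar_lt_le_trans with r; [exact Hr|].
  apply Rbar_not_lt_le. intros Hlt. apply (CV_disk_outside u r).
  - now rewrite Rabs_pos_eq by lra.
  - apply ex_series_lim_0.
    apply (ex_series_le (fun n => u n * r ^ n)%R (fun n => Rabs (u n) * r ^ n)%R); [|exact H].
    intros n. unfold norm. simpl. unfold abs. simpl. rewrite Rabs_mult.
    rewrite (Rabs_pos_eq (r ^ n)); [apply Rle_refl|apply pow_le; lra].
Qed.

(** With u = (x-z0)/(1-z0), the quotient of 1-x by 1-z0 is 1-u. Principal powers of quotients need
    not split, so the power and the series are compared along the segment from z0 to x, on which the
    principal logarithm is differentiable. *)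
Lemma Cpower_expand e z0 x :
  (forall t : R, (0 <= t <= 1)%R -> slit_plane (z0 + t * (x - z0))) ->
  (Cmod (x - z0) < Cmod (1 - z0))%R ->
  C_pseries (binc (- e)) ((x - z0) / (1 - z0)) (Cpower (1 - x) e * Cpower (1 - z0) (- e)).
Proof.
  intros Hseg Hx.
  assert (Hz0 : 1 - z0 <> 0).
  { intros E. rewrite E, Cmod_0 in Hx. pose proof (Cmod_ge_0 (x - z0)). lra. }
  assert (Hz0m := proj1 (Cmod_gt_0 _) Hz0).
  set (u := (x - z0) / (1 - z0)).
  assert (Hu : (Cmod u < 1)%R).
  { unfold u. rewrite Cmod_div by exact Hz0.
    apply (Rmult_lt_reg_r (Cmod (1 - z0))); [exact Hz0m|]. field_simplify; lra. }
  set (c := fun n => binc (- e) n * u ^ n).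
  assert (Hum := Cmod_ge_0 u).
  (* r > 1 and |u| r < 1, so the series in t converges beyond t = 1 and may be differentiated
     there. *)
  set (r := (2 / (1 + Cmod u))%R).
  assert (Hr : (1 < r)%R).
  { unfold r. apply (Rmult_lt_reg_r (1 + Cmod u)); [lra|]. field_simplify; lra. }
  assert (Hur : (0 <= Cmod u * r < 1)%R).
  { split; [nra|]. unfold r. apply (Rmult_lt_reg_r (1 + Cmod u)); [lra|]. field_simplify; lra. }
  assert (Hab : ex_series (fun n => Cmod (c n) * r ^ n)%R).
  { apply (ex_series_ext (fun n => Cmod (binc (- e) n) * (Cmod u * r) ^ n)%R).
    - intros n. unfold c. rewrite Cmod_mult, Cmod_pow, Rpow_mult_distr.
      exact (eq_sym (Rmult_assoc _ _ _)).
    - now apply binc_abs. }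
  assert (Hpart : forall g : C -> R, (forall z, (Rabs (g z) <= Cmod z)%R) ->
    Rbar_lt 1 (CV_radius (fun n => g (c n)))).
  { intros g Hg. apply (CV_radius_gt_1 _ r Hr).
    apply (ex_series_le (fun n => Rabs (g (c n)) * r ^ n)%R (fun n => Cmod (c n) * r ^ n)%R);
      [|exact Hab].
    intros n. unfold norm. simpl. unfold abs. simpl.
    rewrite Rabs_mult, Rabs_Rabsolu, (Rabs_pos_eq (r ^ n)) by (apply pow_le; lra).
    apply Rmult_le_compat_r; [apply pow_le; lra|apply Hg]. }
  assert (R1 := Hpart fst Rabs_fst_le). assert (R2 := Hpart snd Rabs_snd_le).
  assert (Ht1 : forall (t : R) a, (0 <= t <= 1)%R -> Rbar_lt 1 a -> Rbar_lt (Rabs t) a).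
  { intros t a Ht. apply Rbar_le_lt_trans. simpl. rewrite Rabs_pos_eq; lra. }
  set (B := fun t : R => (PSeries (fun n => fst (c n)) t, PSeries (fun n => snd (c n)) t) : C).
  assert (HB : forall t : R, (0 <= t <= 1)%R -> C_pseries c t (B t)).
  { intros t Ht. apply real_pseries; now apply Ht1. }
  set (c' := fun n : nat => (n + 1) * c (S n)).
  assert (F1 : forall n, fst (c' n) = PS_derive (fun n => fst (c n)) n).
  { intros n. unfold c', PS_derive. rewrite <- RtoC_INR_S. simpl. ring. }
  assert (F2 : forall n, snd (c' n) = PS_derive (fun n => snd (c n)) n).
  { intros n. unfold c', PS_derive. rewrite <- RtoC_INR_S. simpl. ring. }
  set (B' := fun t : R => (PSeries (fun n => fst (c' n)) t, PSeries (fun n => snd (c' n)) t) : C).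
  assert (HB' : forall t : R, (0 <= t <= 1)%R -> C_pseries c' t (B' t)).
  { intros t Ht. apply real_pseries.
    - rewrite (CV_radius_ext _ _ F1), CV_radius_derive. now apply Ht1.
    - rewrite (CV_radius_ext _ _ F2), CV_radius_derive. now apply Ht1. }
  assert (DB : forall t : R, (0 <= t <= 1)%R -> Cder B t (B' t)).
  { intros t Ht. split; simpl.
    - rewrite (PSeries_ext _ _ _ F1). apply is_derive_PSeries. now apply Ht1.
    - rewrite (PSeries_ext _ _ _ F2). apply is_derive_PSeries. now apply Ht1. }
  (* (1 - t u) B' = - e u B; on coefficients it is the recurrence of [binc (- e)]. *)
  assert (ODE : forall t : R, (0 <= t <= 1)%R -> B' t = u * (t * B' t - e * B t)).
  { intros t Ht. apply (C_pseries_unique c' t); [now apply HB'|].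
    apply (C_pseries_ext (fun n => u * (delay c' n + (- e) * c n))).
    - intros n. transitivity (u * ((n - e) * c n)).
      + f_equal. destruct n as [|n]; [simpl; ring|]. rewrite RtoC_INR_S. unfold delay, c'. ring.
      + unfold c', c. rewrite Cpow_S.
        transitivity (u * u ^ n * ((n + 1) * binc (- e) (S n))); [rewrite binc_S|]; ring.
    - replace (u * (t * B' t - e * B t)) with (u * (t * B' t + (- e) * B t)) by ring.
      apply C_pseries_scal, C_pseries_plus.
      + apply C_pseries_delay. now apply HB'.
      + apply C_pseries_scal. now apply HB. }
  assert (Hpq : forall t : R, 1 - (z0 + t * (x - z0)) = (1 - z0) + t * (z0 - x))
    by (intros; ring).
  assert (Hne : forall t : R, (0 <= t <= 1)%R -> 1 - z0 + t * (z0 - x) <> 0).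
  { intros t Ht E. pose proof (slit_plane_pos _ (Hseg t Ht)) as H.
    rewrite Hpq, E, Cmod_0 in H. simpl in H. lra. }
  (* By the equation for B, the product of B with the power of exponent -e is constant in t; t = 0
     and t = 1 give the claim. *)
  assert (Const := Cder_0_const (fun t => Cpower (1 - z0 + t * (z0 - x)) (- e) * B t)).
  assert (HB0 : B 0%R = 1).
  { unfold B. rewrite !PSeries_0. unfold c. rewrite binc_0. simpl.
    unfold RtoC. f_equal; ring. }
  assert (HB1 : B 1%R = Cpower (1 - x) e * Cpower (1 - z0) (- e)).
  { assert (E : Cpower (1 - x) (- e) * B 1%R = Cpower (1 - z0) (- e)).
    { transitivity (Cpower (1 - z0 + 1 * (z0 - x)) (- e) * B 1%R);
        [f_equal; f_equal; ring|].
      rewrite Const.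
      - rewrite HB0. replace (1 - z0 + 0 * (z0 - x)) with (1 - z0) by ring. ring.
      - intros t Ht.
        eapply Cder_eq; [apply Cder_mult; [apply Cder_Cpower|now apply DB]|].
        + rewrite <- Hpq. apply slit_plane_pos. now apply Hseg.
        + specialize (Hne t Ht). specialize (ODE t Ht).
          assert (E : B' t * (1 - z0 + t * (z0 - x)) = - e * (x - z0) * B t).
          { assert (Eu : x - z0 = u * (1 - z0)) by (unfold u; field; exact Hz0).
            transitivity (B' t * (1 - z0) - t * (x - z0) * B' t); [ring|].
            rewrite ODE at 1. rewrite Eu. ring. }
          replace (B' t) with (- e * (x - z0) * B t / (1 - z0 + t * (z0 - x)))
            by (rewrite <- E; field; exact Hne).
          field. exact Hne. }
    rewrite <- E, Cmult_assoc, Cpower_opp. ring. }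
  assert (H1 := HB 1%R ltac:(lra)). rewrite HB1 in H1.
  apply C_pseries_iff. apply C_pseries_iff in H1.
  refine (Cser_ext _ _ _ _ H1). intros n. unfold c. rewrite Cpow_1_l. ring.
Qed.

(** * Euler's integral *)

Definition Ccont (f : R -> C) (t : R) : Prop :=
  continuity_pt (fun s => fst (f s)) t /\ continuity_pt (fun s => snd (f s)) t.

Lemma Cder_cont f t l : Cder f t l -> Ccont f t.
Proof.
  intros [H1 H2]. split; apply continuity_pt_filterlim.
  - apply (ex_derive_continuous (fun s => fst (f s))). now exists (fst l).
  - apply (ex_derive_continuous (fun s => snd (f s))). now exists (snd l).
Qed.

Lemma Ccont_const c t : Ccont (fun _ => c) t.
Proof. split; apply continuity_pt_const; now intros ? ?. Qed.

Lemma Ccont_id t : Ccont (fun s => RtoC s) t.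
Proof.
  split; simpl.
  - apply derivable_continuous_pt, derivable_pt_id.
  - apply continuity_pt_const; now intros ? ?.
Qed.

Lemma Ccont_plus f g t : Ccont f t -> Ccont g t -> Ccont (fun s => f s + g s) t.
Proof.
  intros [F1 F2] [G1 G2]. split.
  - exact (continuity_pt_plus _ _ _ F1 G1).
  - exact (continuity_pt_plus _ _ _ F2 G2).
Qed.

Lemma Ccont_mult f g t : Ccont f t -> Ccont g t -> Ccont (fun s => f s * g s) t.
Proof.
  intros [F1 F2] [G1 G2]. split.
  - exact (continuity_pt_minus _ _ _ (continuity_pt_mult _ _ _ F1 G1)
      (continuity_pt_mult _ _ _ F2 G2)).
  - exact (continuity_pt_plus _ _ _ (continuity_pt_mult _ _ _ F1 G2)
      (continuity_pt_mult _ _ _ F2 G1)).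
Qed.

Lemma Ccont_pow f n t : Ccont f t -> Ccont (fun s => f s ^ n) t.
Proof.
  intros H. induction n as [|n IH]; [apply (Ccont_const 1)|].
  now apply (Ccont_mult f (fun s => f s ^ n)).
Qed.

Lemma Ccont_inv f t : Ccont f t -> f t <> 0 -> Ccont (fun s => / f s) t.
Proof.
  intros [F1 F2] H.
  assert (N : (fst (f t) ^ 2 + snd (f t) ^ 2 <> 0)%R).
  { intros E. apply H. destruct (f t) as [p q]. simpl in E. unfold RtoC. f_equal; nra. }
  assert (D : continuity_pt (fun s => fst (f s) ^ 2 + snd (f s) ^ 2)%R t).
  { apply (continuity_pt_plus (fun s => fst (f s) ^ 2)%R (fun s => snd (f s) ^ 2)%R);
      simpl; repeat apply (continuity_pt_mult _ _ t); auto;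
      apply continuity_pt_const; now intros ? ?. }
  split; simpl.
  - exact (continuity_pt_div _ _ _ F1 D N).
  - exact (continuity_pt_div _ _ _ (continuity_pt_opp _ _ F2) D N).
Qed.

Lemma Ccont_sum (f : nat -> R -> C) n t : (forall k, Ccont (f k) t) ->
  Ccont (fun s => sum_n (fun k => f k s) n) t.
Proof.
  intros H. induction n as [|n IH].
  - destruct (H 0%nat) as [H1 H2].
    split; (eapply continuity_pt_ext; [intros s; now rewrite csum_O|assumption]).
  - destruct (Ccont_plus _ _ _ IH (H (S n))) as [H1 H2].
    split; (eapply continuity_pt_ext; [intros s; now rewrite csum_S|assumption]).
Qed.

Definition Ccont01 (f : R -> C) : Prop := forall t : R, (0 <= t <= 1)%R -> Ccont f t.

Lemma Ccont01_bounded f : Ccont01 f ->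
  exists M : R, forall s : R, (0 <= s <= 1)%R -> (Cmod (f s) <= M)%R.
Proof.
  intros H.
  destruct (continuity_ab_maj (fun s => Rabs (fst (f s)) + Rabs (snd (f s)))%R 0 1) as [m [Hm _]].
  - lra.
  - intros t Ht. destruct (H t Ht) as [H1 H2].
    apply (continuity_pt_plus (fun s => Rabs (fst (f s))) (fun s => Rabs (snd (f s))));
      apply (continuity_pt_comp _ Rabs); auto; apply Rcontinuity_abs.
  - eexists. intros s Hs. eapply Rle_trans; [apply Cmod_le_Rabs|]. now apply Hm.
Qed.

Definition CInt (f : R -> C) : C :=
  (RInt (fun s => fst (f s)) 0 1, RInt (fun s => snd (f s)) 0 1).

Lemma ex_RInt_fst f : Ccont01 f -> ex_RInt (fun s => fst (f s)) 0 1.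
Proof.
  intros H. apply (ex_RInt_continuous (V := R_CompleteNormedModule)). intros t.
  rewrite Rmin_left, Rmax_right by lra. intros Ht. apply continuity_pt_filterlim, (H t Ht).
Qed.

Lemma ex_RInt_snd f : Ccont01 f -> ex_RInt (fun s => snd (f s)) 0 1.
Proof.
  intros H. apply (ex_RInt_continuous (V := R_CompleteNormedModule)). intros t.
  rewrite Rmin_left, Rmax_right by lra. intros Ht. apply continuity_pt_filterlim, (H t Ht).
Qed.

Lemma CInt_ext f g : (forall s : R, (0 <= s <= 1)%R -> f s = g s) -> CInt f = CInt g.
Proof.
  intros H. unfold CInt. f_equal; apply RInt_ext; intros s;
    rewrite Rmin_left, Rmax_right by lra; intros Hs; now rewrite H by lra.
Qed.

Lemma CInt_plus f g : Ccont01 f -> Ccont01 g -> CInt (fun s => f s + g s) = CInt f + CInt g.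
Proof.
  intros Hf Hg. unfold CInt, Cplus. simpl. f_equal.
  - exact (RInt_plus _ _ _ _ (ex_RInt_fst f Hf) (ex_RInt_fst g Hg)).
  - exact (RInt_plus _ _ _ _ (ex_RInt_snd f Hf) (ex_RInt_snd g Hg)).
Qed.

Lemma CInt_scal c f : Ccont01 f -> CInt (fun s => c * f s) = c * CInt f.
Proof.
  intros Hf.
  assert (S : forall k (h : R -> R), ex_RInt h 0 1 ->
    ex_RInt (fun s => k * h s)%R 0 1 /\ RInt (fun s => k * h s)%R 0 1 = (k * RInt h 0 1)%R).
  { intros k h Hh. split.
    - exact (ex_RInt_scal (V := R_NormedModule) h 0 1 k Hh).
    - exact (RInt_scal h 0 1 k Hh). }
  destruct c as [p q]. unfold CInt, Cmult. simpl.
  destruct (S p _ (ex_RInt_fst f Hf)) as [X1 E1].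
  destruct (S q _ (ex_RInt_snd f Hf)) as [X2 E2].
  destruct (S p _ (ex_RInt_snd f Hf)) as [X3 E3].
  destruct (S q _ (ex_RInt_fst f Hf)) as [X4 E4].
  rewrite <- E1, <- E2, <- E3, <- E4. f_equal.
  - exact (RInt_minus _ _ _ _ X1 X2).
  - exact (RInt_plus _ _ _ _ X3 X4).
Qed.

Lemma CInt_sum (f : nat -> R -> C) n : (forall k, Ccont01 (f k)) ->
  CInt (fun s => sum_n (fun k => f k s) n) = sum_n (fun k => CInt (f k)) n.
Proof.
  intros H. induction n as [|n IH].
  - rewrite csum_O. apply CInt_ext. intros. now rewrite csum_O.
  - rewrite csum_S, <- IH, <- CInt_plus; [|intros t Ht; apply Ccont_sum; intros k; now apply H|apply H].
    apply CInt_ext. intros. now rewrite csum_S.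
Qed.

(** The factor 2 comes from bounding the two coordinates separately; it is harmless in
    [CInt_series]. *)
Lemma CInt_bound f M : Ccont01 f -> (forall s : R, (0 <= s <= 1)%R -> (Cmod (f s) <= M)%R) ->
  (Cmod (CInt f) <= 2 * M)%R.
Proof.
  intros Hf HM. eapply Rle_trans; [apply Cmod_le_Rabs|].
  assert (B : forall h : R -> R, ex_RInt h 0 1 ->
    (forall s, (Rabs (h s) <= Cmod (f s))%R) -> (Rabs (RInt h 0 1) <= M)%R).
  { intros h Hh Hle. replace M with ((1 - 0) * M)%R by ring.
    apply abs_RInt_le_const; [lra|exact Hh|].
    intros s Hs. eapply Rle_trans; [apply Hle|now apply HM]. }
  assert (B1 := B _ (ex_RInt_fst f Hf) (fun s => Rabs_fst_le (f s))).
  assert (B2 := B _ (ex_RInt_snd f Hf) (fun s => Rabs_snd_le (f s))).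
  unfold CInt. simpl fst. simpl snd. lra.
Qed.

(** Termwise integration under a summable majorant. The threshold eps/2 in the proof absorbs the
    factor 2 of [CInt_bound]. *)
Lemma CInt_series (psi : nat -> R -> C) (Phi : R -> C) (M : nat -> R) (S : R) :
  (forall n, Ccont01 (psi n)) -> Ccont01 Phi ->
  (forall s : R, (0 <= s <= 1)%R -> Cser (fun n => psi n s) (Phi s)) ->
  (forall n (s : R), (0 <= s <= 1)%R -> (Cmod (psi n s) <= M n)%R) ->
  is_series M S -> Cser (fun n => CInt (psi n)) (CInt Phi).
Proof.
  intros Hpsi HPhi Hser HM HS. apply is_series_Cser_of_dist. intros eps.
  assert (Heps : (0 < eps / 2)%R) by (destruct eps; simpl; lra).
  destruct (proj1 (filterlim_locally _ _) HS (mkposreal _ Heps)) as [N HN].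
  exists N. intros n Hn. specialize (HN n Hn).
  assert (HN' : (Rabs (sum_n M n - S) < eps / 2)%R) by exact HN. clear HN.
  set (f := fun s => Phi s + (-1) * sum_n (fun k => psi k s) n).
  assert (Hsum : Ccont01 (fun s => sum_n (fun k => psi k s) n)).
  { intros t Ht. apply Ccont_sum. intros k. now apply Hpsi. }
  assert (Hsum' : Ccont01 (fun s => (-1) * sum_n (fun k => psi k s) n)).
  { intros t Ht. apply (Ccont_mult (fun _ => RtoC (-1))); [apply Ccont_const|now apply Hsum]. }
  assert (E : sum_n (fun n => CInt (psi n)) n - CInt Phi = - CInt f).
  { unfold f. rewrite CInt_plus, CInt_scal, CInt_sum by assumption. ring. }
  rewrite E, Cmod_opp.
  apply Rle_lt_trans with (2 * (S - sum_n M n))%R.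
  - apply CInt_bound.
    + intros t Ht. apply Ccont_plus; auto.
    + intros s Hs. unfold f.
      replace (Phi s + (-1) * _) with (Phi s - sum_n (fun k => psi k s) n) by ring.
      apply Cser_tail_bound; auto.
  - rewrite Rabs_minus_sym in HN'. apply Rabs_def2 in HN'. lra.
Qed.

(* [s ^ g] for [s >= 0], with the value [0] at [s = 0] that [Cpower] does not have. *)
Definition pw (g : C) (s : R) : C :=
  if Rle_dec s 0 then 0 else Cexp (g * ln s).

Lemma pw_pos g s : (0 < s)%R -> pw g s = Cexp (g * ln s).
Proof. intros H. unfold pw. destruct (Rle_dec s 0); [lra|reflexivity]. Qed.

Lemma pw_nonpos g s : (s <= 0)%R -> pw g s = 0.
Proof. intros H. unfold pw. destruct (Rle_dec s 0); [reflexivity|lra]. Qed.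

Lemma Cexp_ln s : (0 < s)%R -> Cexp (ln s) = s.
Proof.
  intros H. unfold Cexp, RtoC, Re, Im. simpl. rewrite exp_ln, cos_0, sin_0 by exact H.
  f_equal; ring.
Qed.

Lemma pw_mult g s : (0 <= s)%R -> pw g s * s = pw (g + 1) s.
Proof.
  intros [H|<-].
  - rewrite !pw_pos by exact H. rewrite <- (Cexp_ln s H) at 1. rewrite <- Cexp_plus.
    f_equal. ring.
  - rewrite !pw_nonpos by lra. ring.
Qed.

Lemma pw_mult_pow g s n : (0 <= s)%R -> pw g s * s ^ n = pw (g + n) s.
Proof.
  intros H. induction n as [|n IH].
  - simpl. rewrite Cplus_0_r. ring.
  - rewrite RtoC_INR_S, Cplus_assoc, <- pw_mult, <- IH, Cpow_S by exact H. ring.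
Qed.

Lemma Cmod_Cexp z : Cmod (Cexp z) = exp (Re z).
Proof.
  unfold Cexp, Cmod. simpl fst. simpl snd.
  replace ((exp (Re z) * cos (Im z)) ^ 2 + (exp (Re z) * sin (Im z)) ^ 2)%R
    with (Rsqr (exp (Re z)) * (Rsqr (sin (Im z)) + Rsqr (cos (Im z))))%R
    by (unfold Rsqr; ring).
  rewrite sin2_cos2, Rmult_1_r. apply sqrt_Rsqr. left. apply exp_pos.
Qed.

Lemma Re_mult_R z (t : R) : Re (z * t) = (Re z * t)%R.
Proof. destruct z. unfold Re. simpl. ring. Qed.

Lemma exp_ln_small g eps : (0 < g)%R -> (0 < eps)%R ->
  exists d, (0 < d)%R /\ forall h, (0 < h < d)%R -> (exp (g * ln h) < eps)%R.
Proof.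
  (* The witness is eps^(1/g). *)
  intros Hg He. exists (exp (ln eps / g)). split; [apply exp_pos|].
  intros h [Hh0 Hh]. rewrite <- (exp_ln eps He). apply exp_increasing.
  apply ln_increasing in Hh; [|exact Hh0]. rewrite ln_exp in Hh.
  apply (Rmult_lt_compat_l g) in Hh; [|exact Hg].
  replace (g * (ln eps / g))%R with (ln eps) in Hh by (field; lra). exact Hh.
Qed.

Lemma Cder_pw_pos g s : (0 < s)%R -> Cder (pw g) s (g * pw (g - 1) s).
Proof.
  intros Hs.
  assert (E : Cder (fun t => Cexp (g * ln t)) s (g * pw (g - 1) s)).
  { assert (L : Cder (fun t => RtoC (ln t)) s (RtoC (/ s))).
    { split; [exact (is_derive_ln s Hs)|exact (is_derive_const (V := R_NormedModule) 0%R s)]. }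
    eapply Cder_eq.
    - apply Cder_exp, (Cder_mult (fun _ => g) (fun t => RtoC (ln t)));
        [apply Cder_const|exact L].
    - assert (Hs0 : RtoC s <> 0) by (intros E; apply RtoC_inj in E; lra).
      rewrite RtoC_inv by lra.
      replace (g * ln s) with ((g - 1) * ln s + ln s) by ring.
      rewrite Cexp_plus, Cexp_ln, pw_pos by exact Hs. field. exact Hs0. }
  assert (L : locally s (fun t => (0 < t)%R)).
  { exists (mkposreal s Hs). intros t Ht. apply Rabs_def2 in Ht. simpl in Ht.
    unfold minus, plus, opp in Ht; simpl in Ht. lra. }
  destruct E as [E1 E2]. split.
  - revert E1. apply is_derive_ext_loc. revert L. apply filter_imp. intros t Ht.
    now rewrite pw_pos.
  - revert E2. apply is_derive_ext_loc. revert L. apply filter_imp. intros t Ht.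
    now rewrite pw_pos.
Qed.

(** At 0 the difference quotient is 0 on the left and has modulus h^(Re g - 1) on the right. So Re g
    > 1 yields a two-sided derivative, as the fundamental theorem on [0, 1] demands. *)
Lemma Cder_pw g s : (1 < Re g)%R -> (0 <= s)%R -> Cder (pw g) s (g * pw (g - 1) s).
Proof.
  intros Hg [Hs|<-]; [now apply Cder_pw_pos|].
  rewrite (pw_nonpos (g - 1)) by lra. rewrite Cmult_0_r.
  assert (K : forall k : C -> R, (forall z, (Rabs (k z) <= Cmod z)%R) -> k 0 = 0%R ->
    is_derive (fun s => k (pw g s)) 0 0%R).
  { intros k Hk Hk0. apply is_derive_Reals. intros eps Heps.
    destruct (exp_ln_small (Re g - 1) eps ltac:(lra) Heps) as (d & Hd & Hsmall).
    exists (mkposreal d Hd). intros h Hh Hhd. simpl in Hhd.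
    rewrite Rplus_0_l, (pw_nonpos g 0), Hk0 by lra.
    destruct (Rle_lt_dec h 0) as [Hh0|Hh0].
    - rewrite pw_nonpos, Hk0 by exact Hh0.
      replace ((0 - 0) / h - 0)%R with 0%R by (field; exact Hh). now rewrite Rabs_R0.
    - rewrite Rabs_pos_eq in Hhd by lra.
      replace ((k (pw g h) - 0) / h - 0)%R with (k (pw g h) / h)%R by (field; exact Hh).
      unfold Rdiv. rewrite Rabs_mult, (Rabs_pos_eq (/ h))
        by (left; now apply Rinv_0_lt_compat).
      eapply Rle_lt_trans; [|apply (Hsmall h); lra].
      apply (Rmult_le_reg_r h); [exact Hh0|].
      rewrite Rmult_assoc, Rinv_l, Rmult_1_r by exact Hh.
      eapply Rle_trans; [apply Hk|].
      rewrite pw_pos, Cmod_Cexp, Re_mult_R by exact Hh0.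
      rewrite <- (exp_ln h Hh0) at 3. rewrite <- exp_plus.
      apply Req_le. f_equal. ring. }
  split; apply K; auto; [apply Rabs_fst_le|apply Rabs_snd_le].
Qed.

Lemma Ccont_pw g s : (0 < Re g)%R -> (0 <= s)%R -> Ccont (pw g) s.
Proof.
  intros Hg [Hs|<-]; [eapply Cder_cont; now apply Cder_pw_pos|].
  assert (K : forall k : C -> R, (forall z, (Rabs (k z) <= Cmod z)%R) -> k 0 = 0%R ->
    continuity_pt (fun s => k (pw g s)) 0).
  { intros k Hk Hk0 eps Heps.
    destruct (exp_ln_small (Re g) eps ltac:(lra) Heps) as (d & Hd & Hsmall).
    exists d. split; [exact Hd|]. intros h [_ Hhd]. simpl in *. unfold R_dist in *.
    rewrite (pw_nonpos g 0), Hk0, Rminus_0_r in * by lra.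
    destruct (Rle_lt_dec h 0) as [Hh0|Hh0].
    - rewrite pw_nonpos, Hk0, Rabs_R0 by exact Hh0. exact Heps.
    - rewrite Rabs_pos_eq in Hhd by lra.
      eapply Rle_lt_trans; [apply Hk|].
      rewrite pw_pos, Cmod_Cexp, Re_mult_R by exact Hh0. apply Hsmall. lra. }
  split; apply K; auto; [apply Rabs_fst_le|apply Rabs_snd_le].
Qed.

Lemma CInt_pw g : (1 < Re g)%R -> CInt (pw (g - 1)) = / g.
Proof.
  intros Hg.
  assert (Hg0 : g <> 0) by (intros ->; simpl in Hg; lra).
  assert (Hc : Ccont01 (pw (g - 1))).
  { intros t Ht. apply Ccont_pw; [|lra]. destruct g. simpl in *. lra. }
  apply (Cmult_eq_reg_l g); [exact Hg0|]. rewrite <- CInt_scal by exact Hc.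
  rewrite Cinv_r by exact Hg0.
  assert (Hc' : Ccont01 (fun s => g * pw (g - 1) s)).
  { intros t Ht. apply (Ccont_mult (fun _ => g)); [apply Ccont_const|now apply Hc]. }
  assert (P1 : pw g 1 = 1).
  { rewrite pw_pos, ln_1, Cmult_0_r by lra. apply Cexp_0. }
  assert (P0 : pw g 0 = 0) by (apply pw_nonpos; lra).
  unfold CInt. apply injective_projections; simpl fst; simpl snd.
  - apply is_RInt_unique.
    assert (H := is_RInt_derive (V := R_CompleteNormedModule) (fun s => fst (pw g s))
      (fun s => fst (g * pw (g - 1) s)) 0 1).
    rewrite Rmin_left, Rmax_right, P1, P0 in H by lra.
    evar_last; [apply H; intros t Ht|unfold minus, plus, opp; simpl; ring].
    + apply Cder_pw; lra.
    + apply continuity_pt_filterlim, Hc', Ht.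
  - apply is_RInt_unique.
    assert (H := is_RInt_derive (V := R_CompleteNormedModule) (fun s => snd (pw g s))
      (fun s => snd (g * pw (g - 1) s)) 0 1).
    rewrite Rmin_left, Rmax_right, P1, P0 in H by lra.
    evar_last; [apply H; intros t Ht|unfold minus, plus, opp; simpl; ring].
    + apply Cder_pw; lra.
    + apply continuity_pt_filterlim, Hc', Ht.
Qed.

Lemma Ccont_ext f g t : (forall s, f s = g s) -> Ccont f t -> Ccont g t.
Proof.
  intros H [H1 H2]. split.
  - exact (continuity_pt_ext _ _ t (fun s => f_equal fst (H s)) H1).
  - exact (continuity_pt_ext _ _ t (fun s => f_equal snd (H s)) H2).
Qed.

(** * Local expansions in the slit plane *)

Lemma slit_plane_ne_1 x : slit_plane x -> 1 - x <> 0.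
Proof.
  intros H E. apply slit_plane_pos in H. rewrite E, Cmod_0 in H. simpl in H. lra.
Qed.

Lemma slit_plane_disc z : (Cmod z < 1)%R -> slit_plane z.
Proof.
  intros H [_ H1]. pose proof (re_le_Cmod z) as H2. pose proof (Rle_abs (Re z)). lra.
Qed.

Lemma slit_plane_open z0 : slit_plane z0 -> exists d, (0 < d)%R /\
  forall z, (Cmod (z - z0) < d)%R -> slit_plane z.
Proof.
  intros H.
  assert (B : forall z, (Rabs (Re z - Re z0) <= Cmod (z - z0))%R /\
    (Rabs (Im z - Im z0) <= Cmod (z - z0))%R).
  { intros z. split; [exact (Rabs_fst_le (z - z0))|exact (Rabs_snd_le (z - z0))]. }
  (* The radius is 1 - Re z0 for real z0 and |Im z0| otherwise. *)
  destruct (Req_dec (Im z0) 0) as [Hi|Hi].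
  - assert (Hr : (Re z0 < 1)%R) by (apply Rnot_le_lt; intros Hr; now apply H).
    exists (1 - Re z0)%R. split; [lra|]. intros z Hz [_ H1].
    destruct (B z) as [B1 _]. pose proof (Rle_abs (Re z - Re z0)). lra.
  - exists (Rabs (Im z0)). split; [now apply Rabs_pos_lt|]. intros z Hz [H1 _].
    destruct (B z) as [_ B2]. rewrite H1, Rminus_0_l, Rabs_Ropp in B2. lra.
Qed.

Lemma slit_plane_ball_segment z0 x d (t : R) :
  (forall z, (Cmod (z - z0) < d)%R -> slit_plane z) ->
  (Cmod (x - z0) < d)%R -> (0 <= t <= 1)%R -> slit_plane (z0 + t * (x - z0)).
Proof.
  intros H Hx Ht. apply H. replace (z0 + t * (x - z0) - z0) with (t * (x - z0)) by ring.
  rewrite Cmod_mult, Cmod_R, Rabs_pos_eq by lra. pose proof (Cmod_ge_0 (x - z0)). nra.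
Qed.

Lemma analytic_Cpower e z0 : slit_plane z0 -> analytic_at (fun z => Cpower (1 - z) e) z0.
Proof.
  intros Hz0. destruct (slit_plane_open z0 Hz0) as (d & Hd & Hslit).
  assert (Hne := slit_plane_ne_1 z0 Hz0).
  exists (fun n => Cpower (1 - z0) e * (binc (- e) n * (/ (1 - z0)) ^ n)),
    (Rmin d (Cmod (1 - z0))). split.
  { apply Rmin_pos; [exact Hd|]. now apply Cmod_gt_0. }
  intros z Hz.
  assert (L1 := Rmin_l d (Cmod (1 - z0))). assert (L2 := Rmin_r d (Cmod (1 - z0))).
  assert (H : C_pseries (binc (- e)) ((z - z0) / (1 - z0))
    (Cpower (1 - z) e * Cpower (1 - z0) (- e))).
  { apply Cpower_expand; [|lra]. intros t Ht.
    apply (slit_plane_ball_segment z0 z d t); [exact Hslit|lra|exact Ht]. }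
  replace (Cpower (1 - z) e) with (Cpower (1 - z0) e *
    (Cpower (1 - z) e * Cpower (1 - z0) (- e))).
  - apply C_pseries_scal. apply C_pseries_iff. apply C_pseries_iff in H.
    refine (Cser_ext _ _ _ _ H). intros n. unfold Cdiv. rewrite Cpow_mult_l. ring.
  - transitivity (Cpower (1 - z) e * (Cpower (1 - z0) e * Cpower (1 - z0) (- e))); [ring|].
    rewrite Cpower_opp. ring.
Qed.

Lemma Cpower_pseries e x : (Cmod x < 1)%R -> C_pseries (binc (- e)) x (Cpower (1 - x) e).
Proof.
  intros Hx.
  assert (H : C_pseries (binc (- e)) ((x - 0) / (1 - 0))
    (Cpower (1 - x) e * Cpower (1 - 0) (- e))).
  { apply Cpower_expand.
    - intros t Ht. apply (slit_plane_ball_segment 0 x 1 t); [|now replace (x - 0) with x by ring|exact Ht].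
      intros z Hz. apply slit_plane_disc. now replace (z - 0) with z in Hz by ring.
    - replace (x - 0) with x by ring. replace (1 - 0) with (RtoC 1) by ring.
      now rewrite Cmod_1. }
  replace (1 - 0) with (RtoC 1) in H by ring.
  rewrite Cpower_1_l, Cmult_1_r in H. now replace ((x - 0) / 1) with x in H by field.
Qed.

(* With [g = d - 1] and [e = c - d], Euler's integral for [2F1(1, c; d; x)]
   is [g (1 - x)^(d - c - 1)] times this one. *)
Definition euler_int (g e x : C) : C :=
  CInt (fun s => pw (g - 1) s * Cpower (1 - s * x) e).

(** Taylor coefficients of [euler_int] at z0, from (1-sx)^e = (1-s z0)^e (1-q)^e with q = s
    (x-z0)/(1-s z0). *)
Definition euler_coef (g e z0 : C) (n : nat) : C :=
  binc (- e) n *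
  CInt (fun s => pw (g - 1) s * (Cpower (1 - s * z0) e * (s / (1 - s * z0)) ^ n)).

Lemma Ccont01_pw g : (1 < Re g)%R -> Ccont01 (pw (g - 1)).
Proof. intros Hg t Ht. apply Ccont_pw; [|lra]. destruct g. simpl in *. lra. Qed.

Lemma Ccont01_Cpower e z : slit_plane z -> Ccont01 (fun s => Cpower (1 - s * z) e).
Proof.
  intros Hz t Ht.
  apply (Ccont_ext (fun s => Cpower (1 + s * (- z)) e)).
  - intros s. f_equal. ring.
  - eapply Cder_cont, Cder_Cpower.
    replace (1 + t * - z) with (1 - t * z) by ring.
    apply slit_plane_pos. now apply slit_plane_star.
Qed.

Lemma Ccont01_ratio z : slit_plane z -> Ccont01 (fun s => s / (1 - s * z)).
Proof.
  intros Hz t Ht. apply (Ccont_mult (fun s => RtoC s)); [apply Ccont_id|].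
  apply Ccont_inv.
  - apply (Ccont_ext (fun s => 1 + (- z) * s)); [intros; ring|].
    apply (Ccont_plus (fun _ => 1)); [apply Ccont_const|].
    apply (Ccont_mult (fun _ => - z)); [apply Ccont_const|apply Ccont_id].
  - apply slit_plane_ne_1. now apply slit_plane_star.
Qed.

(** The number rho bounds |q| uniformly in s, so the binomial series has a summable majorant
    independent of s. Segments scaled by s stay in the slit plane because it is star-shaped about
    0. *)
Lemma euler_int_expand g e z0 x (rho : R) : (1 < Re g)%R ->
  (forall t : R, (0 <= t <= 1)%R -> slit_plane (z0 + t * (x - z0))) ->
  (0 <= rho < 1)%R ->
  (forall s : R, (0 <= s <= 1)%R -> (Cmod (s * (x - z0)) <= rho * Cmod (1 - s * z0))%R) ->
  C_pseries (euler_coef g e z0) (x - z0) (euler_int g e x).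
Proof.
  intros Hg Hseg Hrho Hs.
  assert (Hz0 : slit_plane z0).
  { replace z0 with (z0 + 0%R * (x - z0)) by ring. apply Hseg. lra. }
  assert (Hx : slit_plane x).
  { replace x with (z0 + 1%R * (x - z0)) by ring. apply Hseg. lra. }
  assert (Cw := Ccont01_pw g Hg).
  assert (Cp := Ccont01_Cpower e z0 Hz0).
  assert (Cr := Ccont01_ratio z0 Hz0).
  set (W := fun s : R => pw (g - 1) s * Cpower (1 - s * z0) e).
  assert (CW : Ccont01 W) by (intros t Ht; apply Ccont_mult; auto).
  destruct (Ccont01_bounded W CW) as [M HM].
  set (q := fun s : R => s / (1 - s * z0) * (x - z0)).
  assert (Hq : forall s : R, (0 <= s <= 1)%R -> (Cmod (q s) <= rho)%R).
  { intros s Hs1.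
    assert (N : 1 - s * z0 <> 0) by (apply slit_plane_ne_1; now apply slit_plane_star).
    assert (N' := proj1 (Cmod_gt_0 _) N).
    unfold q. replace (s / (1 - s * z0) * (x - z0)) with (s * (x - z0) / (1 - s * z0))
      by (field; exact N).
    rewrite Cmod_div by exact N. apply (Rmult_le_reg_r (Cmod (1 - s * z0))); [exact N'|].
    unfold Rdiv. rewrite Rmult_assoc, Rinv_l, Rmult_1_r by lra. now apply Hs. }
  destruct (binc_abs (- e) rho Hrho) as [S HS].
  apply C_pseries_iff.
  refine (Cser_ext _ _ _ _ (CInt_series (fun n s => binc (- e) n * (x - z0) ^ n *
    (pw (g - 1) s * (Cpower (1 - s * z0) e * (s / (1 - s * z0)) ^ n)))
    (fun s => pw (g - 1) s * Cpower (1 - s * x) e)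
    (fun n => M * (Cmod (binc (- e) n) * rho ^ n))%R (M * S)%R _ _ _ _ _)).
  - intros n. rewrite CInt_scal.
    + unfold euler_coef. ring.
    + intros t Ht. apply Ccont_mult; [now apply Cw|].
      apply Ccont_mult; [now apply Cp|apply Ccont_pow; now apply Cr].
  - intros n t Ht. apply (Ccont_mult (fun _ => binc (- e) n * (x - z0) ^ n));
      [apply Ccont_const|].
    apply Ccont_mult; [now apply Cw|].
    apply Ccont_mult; [now apply Cp|apply Ccont_pow; now apply Cr].
  - intros t Ht. apply Ccont_mult; [now apply Cw|now apply Ccont01_Cpower].
  - intros s Hs1.
    assert (N : 1 - s * z0 <> 0) by (apply slit_plane_ne_1; now apply slit_plane_star).
    assert (N' := proj1 (Cmod_gt_0 _) N).
    assert (P : C_pseries (binc (- e)) ((s * x - s * z0) / (1 - s * z0))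
      (Cpower (1 - s * x) e * Cpower (1 - s * z0) (- e))).
    { apply Cpower_expand.
      - intros t Ht. replace (s * z0 + t * (s * x - s * z0)) with (s * (z0 + t * (x - z0)))
          by ring. apply slit_plane_star; [now apply Hseg|exact Hs1].
      - replace (s * x - s * z0) with (s * (x - z0)) by ring.
        specialize (Hs s Hs1). nra. }
    apply C_pseries_iff in P. apply (Cser_scal (W s)) in P.
    replace (pw (g - 1) s * Cpower (1 - s * x) e) with
      (W s * (Cpower (1 - s * x) e * Cpower (1 - s * z0) (- e))).
    + refine (Cser_ext _ _ _ _ P). intros n. unfold W.
      replace ((s * x - s * z0) / (1 - s * z0)) with (s / (1 - s * z0) * (x - z0))
        by (field; exact N).
      rewrite Cpow_mult_l. ring.
    + unfold W. transitivity (pw (g - 1) s * Cpower (1 - s * x) e *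
        (Cpower (1 - s * z0) e * Cpower (1 - s * z0) (- e))); [ring|].
      rewrite Cpower_opp. ring.
  - intros n s Hs1.
    replace (binc (- e) n * (x - z0) ^ n *
      (pw (g - 1) s * (Cpower (1 - s * z0) e * (s / (1 - s * z0)) ^ n)))
      with (W s * (binc (- e) n * q s ^ n)) by (unfold W, q; rewrite Cpow_mult_l; ring).
    rewrite !Cmod_mult, Cmod_pow.
    apply Rmult_le_compat; [apply Cmod_ge_0| |now apply HM|].
    + apply Rmult_le_pos; [apply Cmod_ge_0|apply pow_le, Cmod_ge_0].
    + apply Rmult_le_compat_l; [apply Cmod_ge_0|]. apply pow_incr.
      split; [apply Cmod_ge_0|now apply Hq].
  - exact (is_series_scal_l (V := R_NormedModule) M _ _ HS).
Qed.

Lemma analytic_euler_int g e z0 : (1 < Re g)%R -> slit_plane z0 ->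
  analytic_at (euler_int g e) z0.
Proof.
  intros Hg Hz0. destruct (slit_plane_open z0 Hz0) as (d & Hd & Hslit).
  (* mu is 1/M for a bound M of 1/|1-s z0| on [0, 1]. With the radius mu/2, every |q| is at most
     1/2. *)
  assert (Hmin : exists mu, (0 < mu)%R /\
    forall s : R, (0 <= s <= 1)%R -> (mu <= Cmod (1 - s * z0))%R).
  { destruct (Ccont01_bounded (fun s => / (1 - s * z0))) as [M HM].
    - intros t Ht. apply Ccont_inv.
      + apply (Ccont_ext (fun s => 1 + (- z0) * s)); [intros; ring|].
        apply (Ccont_plus (fun _ => 1)); [apply Ccont_const|].
        apply (Ccont_mult (fun _ => - z0)); [apply Ccont_const|apply Ccont_id].
      + apply slit_plane_ne_1. now apply slit_plane_star.
    - assert (N : forall s : R, (0 <= s <= 1)%R -> (0 < Cmod (1 - s * z0))%R).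
      { intros s Hs. apply Cmod_gt_0, slit_plane_ne_1. now apply slit_plane_star. }
      assert (HM' : forall s : R, (0 <= s <= 1)%R -> (1 <= M * Cmod (1 - s * z0))%R).
      { intros s Hs. specialize (HM s Hs). specialize (N s Hs).
        rewrite Cmod_inv in HM by now apply Cmod_gt_0.
        apply (Rmult_le_compat_r (Cmod (1 - s * z0))) in HM; [|lra].
        rewrite Rinv_l in HM by lra. exact HM. }
      assert (HM0 : (0 < M)%R).
      { specialize (HM' 0%R ltac:(lra)). specialize (N 0%R ltac:(lra)). nra. }
      exists (/ M)%R. split; [now apply Rinv_0_lt_compat|]. intros s Hs.
      apply (Rmult_le_reg_l M); [exact HM0|]. rewrite Rinv_r by lra. now apply HM'. }
  destruct Hmin as (mu & Hmu & Hmin).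
  exists (euler_coef g e z0), (Rmin d (mu / 2)). split; [apply Rmin_pos; lra|].
  intros z Hz.
  assert (L1 := Rmin_l d (mu / 2)). assert (L2 := Rmin_r d (mu / 2)).
  apply (euler_int_expand g e z0 z (/ 2)); [exact Hg| |lra|].
  - intros t Ht. apply (slit_plane_ball_segment z0 z d t); [exact Hslit|lra|exact Ht].
  - intros s Hs. specialize (Hmin s Hs). rewrite Cmod_mult, Cmod_R, Rabs_pos_eq by lra.
    pose proof (Cmod_ge_0 (z - z0)). nra.
Qed.

(** The expansion at z0 = 0, where the integrals are those of s^(g+n-1), with value 1/(g+n). *)
Lemma euler_int_pseries g e x : (1 < Re g)%R -> (Cmod x < 1)%R ->
  C_pseries (fun n => binc (- e) n / (g + n)) x (euler_int g e x).
Proof.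
  intros Hg Hx.
  assert (H : C_pseries (euler_coef g e 0) (x - 0) (euler_int g e x)).
  { apply (euler_int_expand g e 0 x (Cmod x)); [exact Hg| | |].
    - intros t Ht. apply (slit_plane_ball_segment 0 x 1 t); [|now replace (x - 0) with x by ring|exact Ht].
      intros z Hz. apply slit_plane_disc. now replace (z - 0) with z in Hz by ring.
    - split; [apply Cmod_ge_0|exact Hx].
    - intros s Hs. replace (1 - s * 0) with (RtoC 1) by ring.
      rewrite Cmod_1, Cmod_mult, Cmod_R, Rabs_pos_eq by lra.
      replace (x - 0) with x by ring. pose proof (Cmod_ge_0 x). nra. }
  replace (x - 0) with x in H by ring. revert H. apply C_pseries_ext.
  intros n. unfold euler_coef, Cdiv. f_equal.
  rewrite <- CInt_pw.
  - apply CInt_ext. intros s Hs. replace (1 - s * 0) with (RtoC 1) by ring.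
    rewrite Cpower_1_l. replace (s * / 1) with (RtoC s) by field.
    rewrite Cmult_1_l, pw_mult_pow by lra. f_equal. ring.
  - pose proof (pos_INR n). destruct g. simpl in *. lra.
Qed.

(** * Continuation of 2F1(1, c; d; x) *)

Lemma hyp_coef_2F1_1 c d n : ~ nonpos_int d ->
  hyp_coef (RtoC 1 :: c :: nil) (d :: nil) n = poch c n / poch d n.
Proof.
  intros Hd. assert (H := nonpos_int_poch d n Hd).
  unfold hyp_coef. cbn [map Cprod fold_right]. rewrite poch_1. field_fact.
Qed.

Lemma Re_gt_not_nonpos_int d : (0 < Re d)%R -> ~ nonpos_int d.
Proof.
  intros H [n ->]. pose proof (pos_INR n). rewrite <- RtoC_opp in H. simpl in H. lra.
Qed.

(** The integral represents 2F1(d-1, d-c; d; x), the Euler transform. Its parameters d-1 and d leave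
    no power of 1-s in the integrand, so only the endpoint 0 needs care. *)
Lemma euler_continuation c d : (2 < Re d)%R ->
  is_hyp_continuation (RtoC 1 :: c :: nil) (d :: nil)
    (fun x => (d - 1) * (Cpower (1 - x) (d - c - 1) * euler_int (d - 1) (c - d) x)).
Proof.
  intros Hd. set (g := d - 1).
  assert (Hg : (1 < Re g)%R) by (unfold g; destruct d; simpl in *; lra).
  assert (Hdn : ~ nonpos_int d) by (apply Re_gt_not_nonpos_int; lra).
  split.
  - intros x Hx.
    assert (P : forall z, (Cmod z < 1)%R ->
      C_pseries (binc (- (d - c - 1))) z (Cpower (1 - z) (d - c - 1)))
      by (intros; now apply Cpower_pseries).
    assert (Q : forall z, (Cmod z < 1)%R ->
      C_pseries (fun n => binc (- (c - d)) n / (g + n)) z (euler_int g (c - d) z))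
      by (intros; now apply euler_int_pseries).
    assert (H := C_pseries_scal g _ _ _ (C_pseries_mult _ _ 1 x _ _
      (fun z Hz => ex_intro _ _ (P z Hz)) (fun z Hz => ex_intro _ _ (Q z Hz)) Hx (P x Hx) (Q x Hx))).
    revert H. apply C_pseries_ext. intros n.
    rewrite hyp_coef_2F1_1, <- conv_scal_r by exact Hdn.
    assert (Hp : forall k, poch (g + 1) k <> 0).
    { intros k. replace (g + 1) with d by (unfold g; ring). now apply nonpos_int_poch. }
    assert (Hgn : forall k : nat, g + k <> 0).
    { intros k E. apply (f_equal Re) in E. pose proof (pos_INR k). destruct g. simpl in *. lra. }
    (* The product is [hgcs g (d - c) 0], whose homogeneous recurrence starts at index 0;
       [hgcs_tail] then gives (c)_n/(d)_n. *)
    rewrite (conv_ext _ (binc (1 - (d - c) - 0%nat)) _ (hgc g (d - c))).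
    + rewrite conv_comm.
      change (conv (hgc g (d - c)) (binc (1 - (d - c) - 0%nat)) n) with (hgcs g (d - c) 0%nat (0 + n)).
      rewrite hgcs_tail by apply Hp. rewrite hgcs_0.
      replace (g - (d - c) + 1) with c by (unfold g; ring).
      replace (g + 0%nat + 1) with d by (unfold g; simpl; ring).
      unfold Cdiv. ring.
    + intros k _. f_equal. simpl. ring.
    + intros k _. apply (Cmult_eq_reg_l (g + k)); [apply Hgn|].
      rewrite hgc_rec by apply Hp. replace (- (c - d)) with (d - c) by ring.
      field. apply Hgn.
  - intros z Hz. apply (analytic_at_mult (fun _ => g)); [apply analytic_at_const|].
    apply (analytic_at_mult (fun x => Cpower (1 - x) (d - c - 1))).
    + now apply analytic_Cpower.
    + now apply analytic_euler_int.
Qed.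

(** The coefficients are (c)_n/(d)_n, and from n = 1 on they are c/d times those for c+1 and d+1,
    delayed by one. *)
Lemma shift_continuation c d F : ~ nonpos_int d ->
  is_hyp_continuation (RtoC 1 :: c + 1 :: nil) (d + 1 :: nil) F ->
  is_hyp_continuation (RtoC 1 :: c :: nil) (d :: nil) (fun x => 1 + c / d * (x * F x)).
Proof.
  intros Hd [F1 F2].
  assert (Hd1 : ~ nonpos_int (d + 1)).
  { intros [n E]. apply Hd. exists (S n). rewrite RtoC_INR_S.
    transitivity (d + 1 - 1); [ring|rewrite E; ring]. }
  assert (Hd0 : d <> 0) by (intros ->; apply Hd; exists 0%nat; simpl; ring).
  split.
  - intros x Hx.
    apply (C_pseries_ext (fun n => match n with O => RtoC 1 | S _ => RtoC 0 end +
      c / d * delay (hyp_coef (RtoC 1 :: c + 1 :: nil) (d + 1 :: nil)) n)).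
    + intros n. rewrite hyp_coef_2F1_1 by exact Hd. destruct n as [|n]; simpl delay.
      * simpl. field. exact Hd0.
      * rewrite hyp_coef_2F1_1 by exact Hd1. rewrite (poch_S_l c), (poch_S_l d).
        field. split; [now apply nonpos_int_poch|exact Hd0].
    + apply C_pseries_plus.
      * apply (C_pseries_finite _ _ _ 0).
        -- intros [|n] Hn; [lia|reflexivity].
        -- rewrite csum_O. simpl. ring.
      * apply C_pseries_scal, C_pseries_delay. now apply F1.
  - intros z Hz. apply (analytic_at_plus (fun _ => 1)); [apply analytic_at_const|].
    apply (analytic_at_mult (fun _ => c / d)); [apply analytic_at_const|].
    apply (analytic_at_mult (fun z => z)); [apply analytic_at_id|now apply F2].
Qed.

Lemma continuation_2F1_1 c d : ~ nonpos_int d ->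
  exists F, is_hyp_continuation (RtoC 1 :: c :: nil) (d :: nil) F.
Proof.
  intros Hd. destruct (INR_unbounded (2 - Re d)) as [N HN].
  revert c d Hd HN. induction N as [|N IH]; intros c d Hd HN.
  - eexists. apply euler_continuation. simpl in HN. lra.
  - destruct (IH (c + 1) (d + 1)) as [F HF].
    + intros [n E]. apply Hd. exists (S n). rewrite RtoC_INR_S.
      transitivity (d + 1 - 1); [ring|rewrite E; ring].
    + rewrite S_INR in HN. destruct d. simpl in *. lra.
    + eexists. eapply shift_continuation; eassumption.
Qed.

(** * The identity on the slit plane *)

Lemma C_pseries_ndelay k c z l : C_pseries c z l -> C_pseries (ndelay k c) z (z ^ k * l).
Proof.
  intros H. induction k as [|k IH].
  - replace (z ^ 0 * l) with l by (simpl; ring). revert H. apply C_pseries_ext.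
    intros n. exact (eq_sym (ndelay_ge 0 c n)).
  - rewrite Cpow_S, <- Cmult_assoc. apply C_pseries_delay in IH. revert IH.
    apply C_pseries_ext. intros n. symmetry. apply ndelay_S.
Qed.

Theorem corollary4
  (a b : C) (r : nat) (hr : (1 <= r)%nat)
  (mv : list nat) (hmv_len : length mv = r)
  (hmv : Forall (fun mj => (1 <= mj)%nat) mv)
  (m : nat) (hm : m = list_sum mv)
  (f : list C) (hf_len : length f = r)
  (hf : Forall (fun fj => ~ nonpos_int fj) f)
  (ha : ~ nonpos_int (a + 1))
  (hab : forall i : nat, (i < m)%nat -> a - b <> i)
  (hfa : Forall2 (fun (fj : C) (mj : nat) =>
           forall i : nat, (i < mj)%nat -> fj - a <> - i) f mv)
  (x : C) (hx : slit_plane x) :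
  Cpower (1 - x) (b + m - 1) *
    hyp (a :: b :: vshift f mv) (a + 1 :: f) x
  = sum_n (fun j : nat =>
      poch (1 - m) j * poch (a - b - m + 1) j / (poch (a + 1) j * fact j) *
      Qhat0 a b f mv m j * x ^ j) (m - 1)%nat
    + x ^ m * (-1) ^ m * poch b m * vpoch (shift f (- a)) mv /
        (poch (a + 1) m * vpoch f mv) *
      hyp (RtoC 1 :: 1 - b + a :: nil) (a + m + 1 :: nil) x.
Proof.
  (* With m >= 1 the difference m - 1 is exact, and the finite sum covers just the indices below
     m. *)
  assert (Hm : (1 <= m)%nat).
  { subst m. destruct hmv as [|m0 mv' Hm0 _]; simpl in *; lia. }
  assert (Hlen : length f = length mv) by congruence.
  assert (HD := poch_sub_neq_0 a b m hab).
  assert (Ham : ~ nonpos_int (a + m + 1)).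
  { intros [n E]. apply ha. exists (n + m)%nat. rewrite RtoC_INR_plus.
    transitivity (a + m + 1 - m); [ring|rewrite E; ring]. }
  destruct (continuation_2F1_1 (1 - b + a) (a + m + 1) Ham) as [G HG].
  rewrite (hyp_eq _ _ _ x HG hx).
  set (p := fun j : nat => poch (1 - m) j * poch (a - b - m + 1) j /
    (poch (a + 1) j * fact j) * Qhat0 a b f mv m j).
  set (K := (-1) ^ m * poch b m * vpoch (shift f (- a)) mv / (poch (a + 1) m * vpoch f mv)).
  set (Rhs := fun z => sum_n (fun j => p j * z ^ j) (m - 1) + K * (z ^ m * G z)).
  set (L := hyp_coef (a :: b :: vshift f mv) (a + 1 :: f)).
  destruct HG as [G1 G2].
  assert (HR : forall z, (Cmod z < 1)%R ->
    C_pseries (conv (binc (1 - b - m)) L) z (Rhs z)).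
  { intros z Hz.
    apply (C_pseries_ext (fun n => (if (n <? m)%nat then p n else 0) +
      K * ndelay m (hyp_coef (RtoC 1 :: 1 - b + a :: nil) (a + m + 1 :: nil)) n)).
    - intros n. unfold L. rewrite (conv_hyp_coef a b f mv m n hm Hlen hf ha).
      destruct (Nat.ltb_spec n m) as [Hn|Hn].
      + rewrite low_coef, ndelay_lt by assumption. unfold p. ring.
      + replace n with (m + (n - m))%nat by lia.
        rewrite high_coef, ndelay_ge by assumption. unfold K. ring.
    - apply C_pseries_plus.
      + apply (C_pseries_finite _ _ _ (m - 1)).
        * intros n Hn. destruct (Nat.ltb_spec n m); [lia|reflexivity].
        * apply csum_ext. intros n Hn. destruct (Nat.ltb_spec n m); [reflexivity|lia].
      + apply C_pseries_scal, C_pseries_ndelay. now apply G1. }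
  (* Dividing the right-hand side by (1-z)^(b+m-1) recovers the series of the left function on the
     disc and stays analytic on the slit plane. *)
  assert (HL : is_hyp_continuation (a :: b :: vshift f mv) (a + 1 :: f)
    (fun z => Cpower (1 - z) (1 - b - m) * Rhs z)).
  { split.
    - intros z Hz.
      assert (P : forall w, (Cmod w < 1)%R ->
        C_pseries (binc (- (1 - b - m))) w (Cpower (1 - w) (1 - b - m)))
        by (intros; now apply Cpower_pseries).
      assert (H := C_pseries_mult _ _ 1 z _ _ (fun w Hw => ex_intro _ _ (P w Hw))
        (fun w Hw => ex_intro _ _ (HR w Hw)) Hz (P z Hz) (HR z Hz)).
      revert H. apply C_pseries_ext. intros n. apply conv_binc_cancel.
    - intros z Hz. apply (analytic_at_mult (fun z => Cpower (1 - z) (1 - b - m))).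
      + now apply analytic_Cpower.
      + apply (analytic_at_plus (fun z => sum_n (fun j => p j * z ^ j) (m - 1))).
        * apply (analytic_at_sum (fun j z => p j * z ^ j)). intros j.
          apply (analytic_at_mult (fun _ => p j)); [apply analytic_at_const|apply analytic_at_pow].
        * apply (analytic_at_mult (fun _ => K)); [apply analytic_at_const|].
          apply (analytic_at_mult (fun z => z ^ m)); [apply analytic_at_pow|now apply G2]. }
  rewrite (hyp_eq _ _ _ x HL hx).
  rewrite Cmult_assoc. replace (1 - b - m) with (- (b + m - 1)) by ring.
  rewrite Cpower_opp, Cmult_1_l. unfold Rhs. f_equal. unfold K, Cdiv. ring.
Qed.
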